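(* Let $S\in\mathbb{S}^d_m$ and let $\nu$ be a Borel probability measure on $\mathbb{R}^d$ with finite second moment. For any $\gamma\in\Gamma(\nu)$ and $G\in\mathcal{M}(S)$ the following are equivalent: (a) $\gamma$ is an optimal plan (a maximizer of $\frac12\int S(x,y)\,d\gamma$ over $\Gamma(\nu)$) and $G$ is an optimal set (a minimizer of $\int\psi_G\,d\nu$ over $\mathcal{M}(S)$); (b) $x\in P_G(y)$ for all $(x,y)\in\operatorname{supp}\gamma$; (c) $x\in P_G(x)\subset P_G(y)$ for $\gamma$-almost every $(x,y)$.
   Context: $\mathbb{S}^d_m$ is the set of symmetric invertible $d\times d$ real matrices with exactly $m$ positive eigenvalues; $S(x,y):=\langle x,Sy\rangle$. A set $G\subset\mathbb{R}^d$ is $S$-monotone if $S(x-y,x-y)\ge0$ for all $x,y\in G$; it is maximal $S$-monotone if it is not a strict subset of another $S$-monotone set; $\mathcal{M}(S)$ denotes the family of maximal $S$-monotone sets. For $G\subset\mathbb{R}^d$, $\psi_G(y):=\sup_{x\in G}\big(S(x,y)-\tfrac12S(x,x)\big)$ and $P_G(y):=\operatorname{argmax}_{x\in G}\big(S(x,y)-\tfrac12S(x,x)\big)$ (equivalently $\operatorname{argmin}_{x\in G}S(x-y,x-y)$), $y\in\mathbb{R}^d$. $\Gamma(\nu)$ is the set of Borel probability measures $\gamma$ on $\mathbb{R}^d\times\mathbb{R}^d$ (coordinates $(x,y)$) with finite second moments, second marginal $\nu$, and such that the $\gamma$-conditional expectation of $y$ given $x$ equals $x$. *)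

(* Defs.v *)
From HB Require Import structures.
From mathcomp Require Import all_boot all_order all_algebra.
From mathcomp Require Import all_classical all_reals all_analysis.
Set Implicit Arguments. Unset Strict Implicit. Unset Printing Implicit Defensive.
Import Order.TTheory GRing.Theory Num.Theory.
Import numFieldNormedType.Exports.
Local Open Scope classical_set_scope.
Local Open Scope ring_scope.

Definition vec (R : realType) (d : nat) := 'rV[R]_d.
HB.instance Definition _ (R : realType) d := NormedModule.copy (vec R d) 'rV[R]_d.
HB.instance Definition _ (R : realType) d :=
  Measurable.copy (vec R d) (g_sigma_algebraType (@open 'rV[R]_d)).

Section Defs.
Variables (R : realType) (d : nat).
Local Notation V := (vec R d).

Definition Sform (S : 'M[R]_d) (x y : V) : R := (x *m S *m y^T) 0 0.

Definition coord (x : V) (i : 'I_d) : R := (x : 'rV[R]_d) 0 i.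
Definition sqn (x : V) : R := \sum_(i < d) coord x i ^+ 2.

Definition in_Sdm (S : 'M[R]_d) (m : nat) : Prop :=
  S^T = S /\ S \in unitmx /\
  exists lam : 'I_d -> R,
    char_poly S = \prod_(i < d) ('X - (lam i)%:P) /\
    #|[set i | 0 < lam i]| = m.

Definition Smonotone (S : 'M[R]_d) (G : set V) : Prop :=
  forall x y, G x -> G y -> 0 <= Sform S (x - y) (x - y).

Definition maxSmonotone (S : 'M[R]_d) (G : set V) : Prop :=
  Smonotone S G /\ forall G', Smonotone S G' -> G `<=` G' -> G' = G.

Definition psi (S : 'M[R]_d) (G : set V) (y : V) : \bar R :=
  ereal_sup [set (Sform S x y - Sform S x x / 2)%:E | x in G].

Definition PG (S : 'M[R]_d) (G : set V) (y : V) : set V :=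
  [set x | G x /\ forall x', G x' ->
     Sform S x' y - Sform S x' x' / 2 <= Sform S x y - Sform S x x / 2].

Definition finite_second_moment (nu : probability V R) : Prop :=
  (\int[nu]_y (sqn y)%:E < +oo)%E.

(* Gamma(nu): finite second moments, second marginal nu, and the
   martingale condition E_gamma[y | x] = x, written via the defining property
   of conditional expectation: for every Borel A, and every coordinate i,
   int_{A x R^d} y_i dgamma = int_{A x R^d} x_i dgamma. *)
Definition Gamma (nu : probability V R) (gamma : probability (V * V)%type R) : Prop :=
  (\int[gamma]_z (sqn z.1 + sqn z.2)%:E < +oo)%E /\
  (forall A : set V, measurable A -> gamma (snd @^-1` A) = nu A) /\
  (forall A : set V, measurable A -> forall i : 'I_d,
     (\int[gamma]_(z in fst @^-1` A) (coord z.2 i)%:E =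
      \int[gamma]_(z in fst @^-1` A) (coord z.1 i)%:E)%E).

Definition optimal_plan (S : 'M[R]_d) (nu : probability V R)
    (gamma : probability (V * V)%type R) : Prop :=
  Gamma nu gamma /\
  forall gamma' : probability (V * V)%type R, Gamma nu gamma' ->
    ((2^-1)%:E * \int[gamma']_z (Sform S z.1 z.2)%:E
       <= (2^-1)%:E * \int[gamma]_z (Sform S z.1 z.2)%:E)%E.

Definition optimal_set (S : 'M[R]_d) (nu : probability V R) (G : set V) : Prop :=
  maxSmonotone S G /\
  forall G', maxSmonotone S G' ->
    (\int[nu]_y psi S G y <= \int[nu]_y psi S G' y)%E.

(* topological support of gamma on R^d x R^d (product topology, basis of
   open rectangles) *)
Definition supp (gamma : probability (V * V)%type R) : set (V * V) :=
  [set z | forall A B : set V, open A -> open B -> A z.1 -> B z.2 ->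
      (0 < gamma (A `*` B))%E].

End Defs.

(* Main.v *)
(* Write c(x) = S(x,x)/2.  Since E[y|x] = x, the value of a plan is E c(x).

   Weak duality: a maximal S-monotone set G projects onto a maximal positive
   subspace of S, so every x has a point g(x) in G with S(g(x)-x, g(x)-x) <= 0 and
   g is continuous.  Testing the martingale property with g in
   psi_G(y) >= S(g(x),y) - c(g(x)) gives
   E psi_G(y) >= E c(x) - E c(g(x)-x) >= E c(x).

   Strong duality: if gamma is optimal, moving an infinitesimal mass kappa gamma to
   its barycenter b, and the rest of each fibre to its new barycenter, gives
   c(b) <= E kappa (S(x,y) - c(x)).  Hence the points (b, E kappa (S(x,y) - c(x)))
   form a convex set above the graph of c.  A maximal convex set E above the graph
   of c containing it touches the graph exactly over a maximal S-monotone set G',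
   because a strongly convex penalisation has a minimiser over E, and the touching
   points satisfy psi_G' <= r on E.  So E psi_G'(y) <= E c(x).

   Thus gamma and G are both optimal iff x is in P_G(y) almost surely, which is a
   closed condition, hence the support form.  Finally, if x' in P_G(x) then
   S(x',y) - c(x') <= S(x,y) - c(x) with equality in conditional mean, whence
   P_G(x) is contained in P_G(y). *)
From Pilot Require Import Defs.
From HB Require Import structures.
From mathcomp Require Import all_boot all_order all_algebra.
From mathcomp Require Import all_classical all_reals all_analysis.
From mathcomp Require Import measurable_realfun ring lra.
Set Implicit Arguments. Unset Strict Implicit. Unset Printing Implicit Defensive.
Import Order.TTheory GRing.Theory Num.Theory.
Import numFieldNormedType.Exports.
Import Pilot.Defs.
Local Open Scope classical_set_scope.
Local Open Scope ring_scope.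

(** * The bilinear form and its diagonalisation *)

(** The form [c] is in general neither convex nor concave, so convex duality enters through
    tangents: S(x,y) - c(x) is the affine tangent of [c] at x, and it lies below c(y) exactly when
    S(x-y,x-y) >= 0. This is how monotone sets become contact sets of convex sets above the graph.
    Moving mass destroys the martingale property. Recentring the fibres restores it with a remainder
    of second order in the moved mass, provided displacements are bounded; hence the bounded
    densities with bounded support. Conditioning on x is expressed by vanishing integrals over
    preimages under [fst], and conditional means come from Radon-Nikodym derivatives. The integral
    of psi_G may be infinite, so comparisons with it are made between extended integrals or after
    truncation. P_G(x) may be uncountable, so its inclusion in P_G(y) cannot be tested point by
    point; a dense sequence of G and rational boxes confine every failure to countably many null
    sets. *)

Section SformTheory.
Variables (R : realType) (d : nat).
Implicit Types (M S : 'M[R]_d) (x y z : vec R d).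

Lemma SformDl M x y z : Sform M (x + y) z = Sform M x z + Sform M y z.
Proof. by rewrite /Sform mulmxDl mulmxDl mxE. Qed.

Lemma SformNl M x z : Sform M (- x) z = - Sform M x z.
Proof. by rewrite /Sform mulNmx mulNmx mxE. Qed.

Lemma SformZl M a x z : Sform M (a *: x) z = a * Sform M x z.
Proof. by rewrite /Sform -scalemxAl -scalemxAl mxE. Qed.

Lemma SformDr M x y z : Sform M z (x + y) = Sform M z x + Sform M z y.
Proof. by rewrite /Sform linearD mulmxDr mxE. Qed.

Lemma SformNr M x z : Sform M z (- x) = - Sform M z x.
Proof. by rewrite /Sform linearN mulmxN mxE. Qed.

Lemma SformZr M a x z : Sform M z (a *: x) = a * Sform M z x.
Proof. by rewrite /Sform linearZ -scalemxAr mxE. Qed.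

Lemma SformC M x y : M^T = M -> Sform M x y = Sform M y x.
Proof.
move=> symM; rewrite /Sform -[in LHS](trmxK (x *m M *m y^T)).
by rewrite mxE !trmx_mul trmxK symM mulmxA.
Qed.

Lemma SformBm A B x y : Sform (A - B) x y = Sform A x y - Sform B x y.
Proof. by rewrite /Sform mulmxBr mulmxBl !mxE. Qed.

Lemma Sform0l M x : Sform M 0 x = 0.
Proof. by rewrite /Sform !mul0mx mxE. Qed.

Lemma Sform_coord M x y :
  Sform M x y = \sum_i \sum_j M i j * (coord x i * coord y j).
Proof.
rewrite /Sform mxE exchange_big /=; apply: eq_bigr => j _.
by rewrite !mxE big_distrl; apply: eq_bigr => i _; rewrite /coord /=; ring.
Qed.

Lemma sqn_ge0 x : 0 <= sqn x.
Proof. by apply: sumr_ge0 => i _; exact: sqr_ge0. Qed.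

Lemma sqn0_eq0 x : sqn x <= 0 -> x = 0.
Proof.
move=> x0; have /eqP : sqn x = 0 by apply: le_anti; rewrite x0 sqn_ge0.
rewrite psumr_eq0 => [/allP xi0|i _]; last exact: sqr_ge0.
apply/rowP => i; have := xi0 i (mem_index_enum i).
by rewrite sqrf_eq0 => /eqP; rewrite /coord mxE.
Qed.

Lemma coord_sqr_le x i : coord x i ^+ 2 <= sqn x.
Proof.
rewrite /sqn (bigD1 i) //= lerDl; apply: sumr_ge0 => j _; exact: sqr_ge0.
Qed.

Lemma Sform_le_sqn M : exists2 K : R, 0 <= K & forall x y,
  `|Sform M x y| <= K * (sqn x + sqn y).
Proof.
exists (\sum_i \sum_j `|M i j|) => [|x y].
  by apply: sumr_ge0 => i _; apply: sumr_ge0.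
rewrite Sform_coord (le_trans (ler_norm_sum _ _ _))// mulr_suml.
apply: ler_sum => i _; rewrite (le_trans (ler_norm_sum _ _ _))// mulr_suml.
apply: ler_sum => j _; rewrite normrM ler_wpM2l//.
have := coord_sqr_le x i; have := coord_sqr_le y j.
rewrite ler_norml; move: (coord x i) (coord y j) => a b hb ha.
by apply/andP; split; nra.
Qed.

End SformTheory.

Section Diagonalization.
Variable R : realType.

(** Polarisation on pairs of basis vectors. *)
Lemma sym_form_eq0 n (S : 'M[R]_n) : S^T = S ->
  (forall x : vec R n, Sform S x x = 0) -> S = 0.
Proof.
move=> symS S0; apply/matrixP => i j; rewrite [RHS]mxE.
have : Sform S (delta_mx 0 i : vec R n) (delta_mx 0 j) = 0.
  have := S0 ((delta_mx 0 i : vec R n) + delta_mx 0 j).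
  rewrite SformDl !SformDr !S0 (SformC _ (delta_mx 0 j) symS); lra.
by rewrite /Sform -rowE trmx_delta -colE !mxE.
Qed.

Lemma exists_unitmx_row n (x : 'rV[R]_n.+1) : x != 0 ->
  exists2 U : 'M[R]_n.+1, U \in unitmx & row 0 U = x.
Proof.
(* The matrix with all rows equal to [x] sends the first basis row to [x] without loss of rank, so
   some invertible matrix agrees with it there. *)
move=> x0; have rk : \rank (delta_mx 0 0 *m (\matrix_(i < n.+1) x) : 'rV_n.+1)
  = \rank (delta_mx 0 0 : 'rV[R]_n.+1).
  by rewrite -rowE rowK mxrank_delta rank_rV x0.
have [g ug eg] := complete_unitmx rk.
by exists g => //; rewrite rowE -eg -rowE rowK.
Qed.

(** Completing the square: a vector with S(x,x) != 0 is made the first basis vector, its value [a]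
    is the pivot, and the Schur complement [N] of the pivot is diagonalised by induction. *)
Lemma sym_congruent_diag n (S : 'M[R]_n) : S^T = S ->
  exists2 P : 'M[R]_n, P \in unitmx &
  exists D : 'rV[R]_n, S = P *m diag_mx D *m P^T.
Proof.
elim: n S => [|n IHn] S symS.
  by exists 1%:M; [exact: unitmx1|exists 0; apply/matrixP => -[]].
have [/sym_form_eq0 S0|] := pselect (forall x : vec R n.+1, Sform S x x = 0).
  exists 1%:M; first exact: unitmx1.
  exists 0; rewrite S0// mul1mx; apply/matrixP => i j.
  by rewrite trmx1 mulmx1 !mxE mul0rn.
move=> /existsNP[x /eqP Sx0].
have x0 : x != 0 by apply: contraNneq Sx0 => ->; rewrite Sform0l.
have [U uU rU] := exists_unitmx_row x0.
pose T : 'M[R]_(1 + n) := U *m S *m U^T.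
have symT : T^T = T by rewrite /T !trmx_mul trmxK symS mulmxA.
have T00 : T 0 0 != 0.
  apply: contraNneq Sx0; rewrite /Sform -rU => <-; apply/eqP.
  rewrite -row_mul /T -[in LHS]/(1 + n)%N !mxE; apply: eq_bigr => k _.
  by rewrite !mxE.
pose a := T 0 0.
pose b : 'rV[R]_n := ursubmx T.
pose N := drsubmx T - a^-1 *: (b^T *m b).
have symN : N^T = N.
  by rewrite linearB linearZ /= trmx_mul trmxK trmx_drsub symT.
have [Q uQ [D ND]] := IHn _ symN.
pose L : 'M[R]_(1 + n) := block_mx 1%:M 0 (a^-1 *: b^T) Q.
have ulE : ulsubmx T = a%:M.
  apply/matrixP => i j; rewrite !ord1 [ulsubmx]lock !mxE /= mulr1n -lock.
  rewrite /ulsubmx /lsubmx /usubmx mxE [LHS]mxE /a.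
  by congr (fun_of_matrix T _ _); apply/val_inj.
have TE : T = L *m diag_mx (row_mx a%:M D) *m L^T.
  rewrite diag_mx_row -[LHS]submxK -/b ulE.
  have -> : dlsubmx T = b^T by rewrite /b trmx_ursub symT.
  have -> : drsubmx T = N + a^-1 *: (b^T *m b) by rewrite subrK.
  have -> : diag_mx (a%:M : 'rV[R]_1) = a%:M.
    by apply/matrixP => i j; rewrite !ord1 !mxE.
  rewrite /L tr_block_mx !mulmx_block !trmx0 !trmx1 !mulmx0 !mul0mx !addr0.
  rewrite !mulmx1 !mul1mx linearZ /= trmxK !add0r.
  rewrite !mul_scalar_mx !mul_mx_scalar !scalerA divff// !scale1r mul0mx addr0.
  by rewrite -scalemxAr ND addrC.
have uL : L \in unitmx.
  by rewrite unitmxE det_lblock det1 mul1r -unitmxE.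
exists (invmx U *m L); first by rewrite unitmx_mul unitmx_inv uU.
exists (row_mx a%:M D).
rewrite trmx_mul !mulmxA -[in RHS](mulmxA (invmx U)) -(mulmxA (invmx U)).
rewrite -TE.
by rewrite /T !mulmxA mulVmx// mul1mx trmx_inv -mulmxA mulmxV ?mulmx1 ?unitmx_tr.
Qed.

Lemma Sform_diag n (P : 'M[R]_n) (D : 'rV[R]_n) (v : vec R n) :
  Sform (P *m diag_mx D *m P^T) v v = \sum_i D 0 i * (v *m P) 0 i ^+ 2.
Proof.
rewrite /Sform !mulmxA -[_ *m P^T *m v^T]mulmxA -trmx_mul mul_mx_diag !mxE.
by apply: eq_bigr => i _; rewrite [in LHS]mxE [(v *m P)^T _ _]mxE; ring.
Qed.

Lemma sqn_Sform n (v : vec R n) : sqn v = Sform 1%:M v v.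
Proof.
rewrite /Sform mulmx1 mxE; apply: eq_bigr => i _.
by rewrite mxE /coord expr2.
Qed.

(** [A] and [B] carry the positive and negative parts of the diagonal, and [A + B] is definite
    because no diagonal entry vanishes. [Pi] projects onto the positive directions: replacing x by
    [x *m Pi] is invisible to [A] and kills [B]. *)
Lemma signature_splitting n (S : 'M[R]_n) : S^T = S -> S \in unitmx ->
  exists A B Pi : 'M[R]_n,
  [/\ A^T = A, B^T = B & S = A - B] /\
  [/\ forall v : vec R n, 0 <= Sform A v v,
      forall v : vec R n, 0 <= Sform B v v & exists2 K : R, 0 <= K &
      forall v : vec R n, sqn v <= K * (Sform A v v + Sform B v v)] /\
  (Pi *m A = A /\ Pi *m B = 0).
Proof.
move=> symS uS; have [P uP [D SE]] := sym_congruent_diag symS.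
have D0 i : D 0 i != 0.
  apply: contraTneq uS => Di0; rewrite SE !unitmx_mul uP unitmx_tr uP andbT /=.
  by rewrite unitmxE det_diag (bigD1 i)//= Di0 mul0r unitr0.
pose Dp : 'rV[R]_n := \row_i Num.max (D 0 i) 0.
pose Dm : 'rV[R]_n := \row_i Num.max (- D 0 i) 0.
pose E : 'rV[R]_n := \row_i (if 0 < D 0 i then 1 else 0).
exists (P *m diag_mx Dp *m P^T), (P *m diag_mx Dm *m P^T).
exists (P *m diag_mx E *m invmx P); split; [split|split; [split|split]].
- by rewrite !trmx_mul trmxK tr_diag_mx mulmxA.
- by rewrite !trmx_mul trmxK tr_diag_mx mulmxA.
- rewrite SE -mulmxBl -mulmxBr -raddfB; congr (_ *m diag_mx _ *m _).
  apply/rowP => i; rewrite !mxE.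
  by case: (ltP (D 0 i) 0) => h; case: (ltP (- D 0 i) 0) => h'; lra.
- move=> v; rewrite Sform_diag; apply: sumr_ge0 => i _.
  by rewrite mulr_ge0 ?sqr_ge0// mxE le_max lexx orbT.
- move=> v; rewrite Sform_diag; apply: sumr_ge0 => i _.
  by rewrite mulr_ge0 ?sqr_ge0// mxE le_max lexx orbT.
- have [K K0 hK] := Sform_le_sqn (invmx P *m (invmx P)^T).
  have s0 : 0 <= \sum_i `|D 0 i|^-1 by apply: sumr_ge0 => i _; rewrite invr_ge0.
  (* [K] bounds the change of basis back from [u = v *m P]; the sum dominates every inverse of an
     absolute diagonal entry, and 2 comes from [sqn u + sqn u]. *)
  exists (K * 2 * \sum_i `|D 0 i|^-1) => [|v]; first by rewrite !mulr_ge0.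
  pose u : vec R n := v *m P.
  have -> : sqn v = Sform (invmx P *m (invmx P)^T) u u.
    rewrite sqn_Sform /Sform mulmx1 /u trmx_mul !mulmxA mulmxK//.
    by rewrite -(mulmxA v) -trmx_mul mulmxV// trmx1 mulmx1.
  rewrite (le_trans (ler_norm _))// (le_trans (hK _ _))// -!mulrA ler_wpM2l//.
  have -> : sqn u + sqn u = 2 * sqn u by ring.
  rewrite ler_wpM2l// !Sform_diag -big_split /= mulr_sumr.
  apply: ler_sum => i _; rewrite /coord -/u -mulrDl mulrA.
  rewrite ler_peMl ?sqr_ge0//.
  have -> : Dp 0 i + Dm 0 i = `|D 0 i|.
    rewrite !mxE; case: (ltP (D 0 i) 0) => h; case: (ltP (- D 0 i) 0) => h'.
    - lra.
    - by rewrite ltr0_norm ?add0r.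
    - by rewrite ger0_norm ?addr0.
    - by rewrite ger0_norm//; lra.
  rewrite -ler_pdivrMr ?normr_gt0// mul1r (bigD1 i)//= lerDl.
  by apply: sumr_ge0 => j _; rewrite invr_ge0.
- rewrite !mulmxA mulmxKV// -(mulmxA P); congr (_ *m _ *m _).
  rewrite mul_diag_mx; apply/matrixP => i j; rewrite !mxE.
  by case: (i =P j) => [->|]; rewrite ?mulr0n ?mulr0// mulr1n; case: (ltP 0 (D 0 j)) => h;
    case: (ltP (D 0 j) 0) => h'; lra.
- rewrite !mulmxA mulmxKV// -(mulmxA P).
  have -> : diag_mx E *m diag_mx Dm = 0; last by rewrite mulmx0 mul0mx.
  rewrite mul_diag_mx; apply/matrixP => i j; rewrite !mxE.
  by case: (i =P j) => [->|]; rewrite ?mulr0n ?mulr0// mulr1n; case: (ltP 0 (D 0 j)) => h;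
    case: (ltP (- D 0 j) 0) => h'; lra.
Qed.

End Diagonalization.

(** * Maximal monotone sets and maximal convex sets above the graph of [c] *)

(** Stands for the limit t -> 0 after an inequality has been divided by t. If e < 0, the value t = -
    e / (|k| - e) gives the contradiction. *)
Lemma ge0_of_small_multiples (R : realType) (k e : R) :
  (forall t, 0 < t <= 1 -> t * k <= e) -> 0 <= e.
Proof.
move=> h; rewrite leNgt; apply/negP => e0.
have k0 := normr_ge0 k.
have p : 0 < `|k| - e by lra.
have := h (- e / (`|k| - e)); rewrite ler_pdivrMr// divr_gt0 ?oppr_gt0// mul1r.
rewrite lerBrDl subrr k0 => /(_ isT); rewrite mulrAC ler_pdivrMr//.
have := ler_norm (- k); rewrite normrN => ? ?; nra.
Qed.

Section Sets.
Variables (R : realType) (d : nat) (S A B Pi : 'M[R]_d).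
Local Notation V := (vec R d).
Local Notation c x := (Sform S x x / 2).
Implicit Types (E : set (V * R)).

(** A pair is a point with a height. A maximal convex set of such pairs above the graph of [c] is
    the epigraph of a minimal convex majorant of [c]. *)
Definition epi_convex E := forall y r y' r' (t : R), E (y, r) -> E (y', r') ->
  0 <= t <= 1 -> E (t *: y + (1 - t) *: y', t * r + (1 - t) * r').

Definition epi_above E := forall y r, E (y, r) -> c y <= r.

Definition epi_maximal E := forall E', E `<=` E' -> epi_convex E' ->
  epi_above E' -> E' `<=` E.

Lemma exists_epi_maximal E0 : E0 !=set0 -> epi_convex E0 -> epi_above E0 ->
  exists E, [/\ E0 `<=` E, epi_convex E, epi_above E & epi_maximal E].
Proof.
move=> [e0 E0e0] cE0 aE0.
(* Containing [E0] is required only of nonempty sets, so that the union of the empty chain is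
   admissible; comparison with [E0] then shows that a maximal set is nonempty. *)
pose P E := [/\ epi_convex E, epi_above E & E !=set0 -> E0 `<=` E].
have [F FP tF|E [[cE aE nE] mE]] := @Zorn_bigcup _ P.
  split.
  - move=> y r y' r' t [X FX Xy] [X' FX' Xy'] t01.
    have [XX'|X'X] := tF _ _ FX FX'.
      by exists X' => //; have [cX' _ _] := FP _ FX'; apply: cX' => //; exact: XX'.
    by exists X => //; have [cX _ _] := FP _ FX; apply: cX => //; exact: X'X.
  - by move=> y r [X FX Xy]; have [_ aX _] := FP _ FX; exact: aX.
  - move=> [e [X FX Xe]] e' E0e'; exists X => //; have [_ _ nX] := FP _ FX.
    by apply: nX => //; exists e.
have neE : E !=set0.
  apply/set0P/negP => /eqP E_0; apply: (mE E0); last by split => // _ ?.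
  by rewrite E_0; split => // /(_ _ E0e0).
exists E; split => //; first exact: nE.
move=> E' EE' cE' aE'; apply: contrapT => nE'.
apply: (mE E'); first by split.
by split => // _; exact: subset_trans (nE neE) EE'.
Qed.

Hypothesis symS : S^T = S.

Lemma qform_convex_comb (y y' : V) t :
  c (t *: y + (1 - t) *: y') = t * c y + (1 - t) * c y' - t * (1 - t) * c (y - y').
Proof.
rewrite !(SformDl, SformDr, SformNl, SformNr, SformZl, SformZr) (SformC y' y symS).
by field.
Qed.

Lemma qform_sub (x y : V) : c (x - y) = c x + c y - Sform S x y.
Proof.
rewrite !(SformDl, SformDr, SformNl, SformNr) (SformC y x symS).
by field.
Qed.

(** The segment from the contact point (x, c x) to (y, r) stays above the graph of [c]; to first
    order at x this says that the tangent of [c] at x is below r. *)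
Lemma epi_touch E x y r : epi_convex E -> epi_above E ->
  E (x, c x) -> E (y, r) -> Sform S x y - c x <= r.
Proof.
move=> cE aE Ex Ey; rewrite -subr_ge0; apply: (@ge0_of_small_multiples _ (c (y - x))).
move=> t /andP[t0 t1].
have := aE _ _ (cE _ _ _ _ t Ey Ex _); rewrite (ltW t0) t1 => /(_ isT).
rewrite qform_convex_comb !qform_sub (SformC y x symS) => h.
rewrite -(ler_pM2l t0); lra.
Qed.

(** Converse of [epi_touch] for maximal sets: the convex hull of [E] and (z, c z) is still above the
    graph of [c], hence is contained in [E]. *)
Lemma epi_maximal_mem E z : E !=set0 -> epi_convex E -> epi_above E ->
  epi_maximal E -> (forall y r, E (y, r) -> Sform S z y - c z <= r) ->
  E (z, c z).
Proof.
move=> [[y0 r0] Ey0] cE aE mE Ez.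
pose E' := [set e : V * R | exists y r (t : R), [/\ E (y, r), 0 <= t <= 1 &
  e = (t *: z + (1 - t) *: y, t * c z + (1 - t) * r)]].
apply: (mE E'); last 1 first.
- by exists y0, r0, 1; split; rewrite ?lexx ?ler01// subrr !scale1r !scale0r !mul0r
    !mul1r !addr0.
- move=> [y r] Ey; exists y, r, 0; split; rewrite ?lexx ?ler01//.
  by rewrite subr0 !scale1r !scale0r !mul0r !mul1r !add0r.
- move=> _ _ _ _ s [y [r [t [Ey t01 [-> ->]]]]] [y' [r' [t' [Ey' t01' [-> ->]]]]] s01.
  pose T := s * t + (1 - s) * t'.
  (* [T] is the total weight put on [z]. If it is 1, the points of [E] have weight 0 and any of them
     serves as witness; otherwise they are averaged with the weight [u]. *)
  have [T1|T1] := eqVneq (1 - T) 0.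
    have h1 : s * (1 - t) = 0 by rewrite /T in T1; nra.
    have h2 : (1 - s) * (1 - t') = 0 by rewrite /T in T1; nra.
    exists y, r, 1; split => //; first by rewrite ler01 lexx.
    have T_1 : T = 1 by move: T1; lra.
    congr (_, _).
      by rewrite !scalerDr !scalerA h1 h2 subrr !scale0r !addr0 -scalerDl -/T T_1.
    transitivity (T * c z + s * (1 - t) * r + (1 - s) * (1 - t') * r').
      by rewrite /T; ring.
    by rewrite h1 h2 T_1; ring.
  have T0 : 0 < 1 - T by rewrite lt_neqAle eq_sym T1 /T; nra.
  pose u := s * (1 - t) / (1 - T).
  have uE : (1 - T) * u = s * (1 - t) by rewrite /u; field.
  have u'E : (1 - T) * (1 - u) = (1 - s) * (1 - t') by rewrite /u /T; field.
  exists (u *: y + (1 - u) *: y'), (u * r + (1 - u) * r'), T; split.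
  + apply: cE => //; rewrite /u ler_pdivrMr// divr_ge0/= ?mul1r ?(ltW T0)//.
      by rewrite /T; nra.
    by nra.
  + by rewrite /T; nra.
  + congr (_, _); last first.
      transitivity (T * c z + (1 - T) * u * r + (1 - T) * (1 - u) * r'); last by ring.
      by rewrite uE u'E /T; ring.
    rewrite !scalerDr !scalerA uE u'E /T scalerDl !addrA.
    by rewrite -!addrA; congr (_ + _); rewrite !addrA; congr (_ + _); rewrite addrC.
- move=> _ _ [y [r [t [Ey t01 [-> ->]]]]]; rewrite qform_convex_comb.
  have := aE _ _ Ey; have := Ez _ _ Ey; rewrite qform_sub.
  move: (c z) (c y) (Sform S z y) => a b f h1 h2.
  (* This is the height above the graph, arranged so that the first summand uses [E] above [c] and
     the second the tangent at [z]. *)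
  have : 0 <= (1 - t) * ((1 - t) * (r - b) + t * (r - b + (a + b - f))).
    by apply: mulr_ge0; [lra|apply: addr_ge0; apply: mulr_ge0; lra].
  by lra.
Qed.

Lemma cvg_Sform (T : Type) (F : set_system T) (FF : Filter F) (M : 'M[R]_d)
    (u v : T -> V) (x y : V) :
  (forall i, coord (u t) i @[t --> F] --> coord x i) ->
  (forall i, coord (v t) i @[t --> F] --> coord y i) ->
  Sform M (u t) (v t) @[t --> F] --> Sform M x y.
Proof.
move=> cu cv; rewrite Sform_coord.
under eq_cvg do rewrite Sform_coord.
apply: (@cvg_big _ _ +%R) => [|i _]; first exact: add_continuous.
apply: (@cvg_big _ _ +%R) => [|j _]; first exact: add_continuous.
by apply: cvgMr; apply: cvgM.
Qed.

Hypotheses (symA : A^T = A) (symB : B^T = B) (SE : S = A - B).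
Hypothesis A_ge0 : forall v : V, 0 <= Sform A v v.
Hypothesis B_ge0 : forall v : V, 0 <= Sform B v v.
Hypothesis AB_pos : exists2 K : R, 0 <= K &
  forall v : V, sqn v <= K * (Sform A v v + Sform B v v).
Hypotheses (PiA : Pi *m A = A) (PiB : Pi *m B = 0).

Let Q (v : V) := Sform A v v + Sform B v v.

(** [Q] dominates the squared coordinates, so each coordinate is a Cauchy sequence. The bound is the
    one that the midpoint inequality gives for a minimising sequence. *)
Lemma exists_limit_coord (y : V ^nat) :
  (forall n k, Q (y n - y k) <= 4 * (n.+1%:R^-1 + k.+1%:R^-1)) ->
  exists x : V, forall i, coord (y n) i @[n --> \oo] --> coord x i.
Proof.
move=> yQ; have [K K0 hK] := AB_pos.
suff cvgi i : cvg (coord (y n) i @[n --> \oo]).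
  exists (\row_i lim (coord (y n) i @[n --> \oo])) => i.
  by rewrite [X in _ --> X]mxE; exact: cvgi.
apply/cauchy_cvgP/cauchy_ballP => e e0; near_simpl.
(* Chosen so that 8 (K + 1) t = e^2; the summand 1 keeps the inequality strict and covers K = 0. *)
pose t : R := e ^+ 2 / (8 * (K + 1)).
have t0 : 0 < t by rewrite divr_gt0 ?exprn_gt0// mulr_gt0//; lra.
have near_t : \forall n \near \oo, n.+1%:R^-1 < t.
  by have /cvgrPdist_lt/(_ _ t0) := @cvg_harmonic R; apply: filterS => n;
    rewrite sub0r normrN ger0_norm ?invr_ge0.
near=> n k; rewrite /ball /=.
have := yQ n k; have := hK (y n - y k); have := coord_sqr_le (y n - y k) i.
have nt : n.+1%:R^-1 < t by near: n.
have kt : k.+1%:R^-1 < t by near: k.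
rewrite -/(Q _) /coord !mxE => h1 h2 h3.
have {}h3 : Q (y n - y k) < 8 * t.
  apply: le_lt_trans h3 _; rewrite (_ : 8 * t = 4 * (t + t)); last by ring.
  by rewrite ltr_pM2l// ltrD.
have h4 : K * Q (y n - y k) <= K * (8 * t) by rewrite ler_wpM2l// ltW.
have h5 : K * (8 * t) < e ^+ 2.
  have -> : e ^+ 2 = (K + 1) * (8 * t) by rewrite /t; field; lra.
  by rewrite ltr_pM2r; [rewrite ltrDl|exact: mulr_gt0].
rewrite -(@ltr_pXn2r _ 2)// ?nnegrE ?(ltW e0)// real_normK ?num_real//; lra.
Unshelve. all: by end_near.
Qed.

Lemma Sform_mulPi_l (x v : V) : Sform A (x *m Pi : V) v = Sform A x v.
Proof. by rewrite /Sform -(mulmxA x) PiA. Qed.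

Lemma SformB_mulPi_l (x v : V) : Sform B (x *m Pi : V) v = 0.
Proof. by rewrite /Sform -(mulmxA x) PiB mulmx0 mul0mx mxE. Qed.

(* The penalised functional [r - c y + A (y - z)] is strongly convex on [E]; its
   minimiser [y] is reflected in the positive directions of [S] to [x]. *)
Lemma epi_maximal_projection E z : E !=set0 -> epi_convex E -> epi_above E ->
  epi_maximal E -> exists2 x, E (x, c x) & Sform A (x - z) (x - z) = 0.
Proof.
move=> E0 cE aE mE.
pose phi (e : V * R) := e.2 - c e.1 + Sform A (e.1 - z) (e.1 - z).
have phi_ge e : E e -> Sform A (e.1 - z) (e.1 - z) <= phi e.
  by case: e => y r Ey; rewrite /phi /= lerDr subr_ge0; exact: aE.
pose m := inf (phi @` E).
have hi : has_inf (phi @` E).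
  split; first by case: E0 => e Ee; exists (phi e); exists e.
  by exists 0 => _ [e Ee <-]; apply: le_trans (phi_ge e Ee).
have m_le e : E e -> m <= phi e.
  by move=> Ee; apply: ge_inf; [exact: hi.2|exists e].
(* The quadratic part of [phi] is A - (A - B)/2 = Q/2, whence the strong convexity. *)
have phi_comb e e' t : phi (t *: e.1 + (1 - t) *: e'.1, t * e.2 + (1 - t) * e'.2)
    = t * phi e + (1 - t) * phi e' - t * (1 - t) / 2 * Q (e.1 - e'.1).
  case: e e' => [y r] [y' r']; rewrite /phi /Q /= SE !SformBm.
  rewrite !(SformDl, SformDr, SformNl, SformNr, SformZl, SformZr).
  rewrite (SformC y' y symA) (SformC y' y symB) !(SformC z _ symA).
  by field.
have /choice[e he] : forall n : nat, exists e, E e /\ phi e < m + n.+1%:R^-1.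
  move=> n; have [|_ [e Ee <-] lt_e] := @inf_adherent _ (phi @` E) (n.+1%:R^-1) _ hi.
    by rewrite invr_gt0.
  by exists e.
have Ee n := (he n).1; have phie n := (he n).2.
have comb t e1 e2 : 0 <= t <= 1 -> E e1 -> E e2 ->
    m <= t * phi e1 + (1 - t) * phi e2 - t * (1 - t) / 2 * Q (e1.1 - e2.1).
  move=> t01 E1 E2; rewrite -phi_comb; apply: m_le.
  by case: e1 e2 E1 E2 => [y r] [y' r'] E1 E2; exact: cE.
have [n k|y cy] := @exists_limit_coord (fun n => (e n).1).
  have half : 0 <= (2^-1 : R) <= 1 by lra.
  have := comb _ _ _ half (Ee n) (Ee k); have := phie n; have := phie k.
  move: (Q _) (phi (e n)) (phi (e k)) (n.+1%:R^-1) (k.+1%:R^-1) => q a b a' b'.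
  by lra.
have cvg_sub x : forall i, coord ((e n).1 - x) i @[n --> \oo] --> coord (y - x) i.
  move=> i; rewrite /coord !mxE; under eq_cvg do rewrite !mxE.
  by apply: cvgB; [exact: cy|exact: cvg_cst].
have cphi : phi (e n) @[n --> \oo] --> m.
  apply: (@squeeze_cvgr _ _ _ _ (fun=> m) (fun n => m + n.+1%:R^-1)).
  - by apply: nearW => n; rewrite m_le// ltW.
  - exact: cvg_cst.
  - rewrite -[X in _ --> X]addr0; apply: cvgD; first exact: cvg_cst.
    exact: cvg_harmonic.
have Ayz : Sform A (y - z) (y - z) <= m.
  apply: ler_cvg_to (cvg_Sform _ (cvg_sub z) (cvg_sub z)) cphi _.
  by apply: nearW => n; exact: phi_ge.
(* Quadratic growth around the minimiser. As [E] is not known to be closed, nothing is evaluated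
   over [y] itself: the inequality is a limit along the minimising sequence, divided by t. *)
have strong x : E x -> m + Q (x.1 - y) / 2 <= phi x.
  move=> Ex; rewrite -subr_ge0.
  apply: (@ge0_of_small_multiples _ (- Q (x.1 - y) / 2)) => t /andP[t0 t1].
  have QE : Q (x.1 - y) = Q (y - x.1).
    by rewrite /Q -opprB !SformNl !SformNr !opprK.
  have : m <= t * phi x + (1 - t) * m - t * (1 - t) / 2 * Q (y - x.1).
    have cv : t * phi x + (1 - t) * phi (e n) -
        t * (1 - t) / 2 * Q ((e n).1 - x.1) @[n --> \oo] -->
        t * phi x + (1 - t) * m - t * (1 - t) / 2 * Q (y - x.1).
      apply: cvgB; last first.
        by apply: cvgMr; apply: cvgD; exact: cvg_Sform.
      by apply: cvgD; [exact: cvg_cst|exact: cvgMr].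
    apply: (cvgr_to_ge cv).
    apply: nearW => n; have := comb t x (e n) _ Ex (Ee n).
    rewrite (ltW t0) t1 => /(_ isT); suff -> : Q (x.1 - (e n).1) = Q ((e n).1 - x.1) by [].
    by rewrite /Q -opprB !SformNl !SformNr !opprK.
  rewrite QE => h; rewrite -(ler_pM2l t0); move: h.
  by move: (phi x) (Q _) => a b; lra.
pose w := z - y.
pose x : V := y + 2 *: (w *m Pi : V).
have AxE u : Sform A x u = Sform A y u + 2 * Sform A w u.
  by rewrite /x SformDl SformZl Sform_mulPi_l.
have BxE u : Sform B x u = Sform B y u.
  by rewrite /x SformDl SformZl SformB_mulPi_l mulr0 addr0.
have xE : x = y + 2 *: (w *m Pi : V) by [].
clearbody x.
have yzw : Sform A (y - z) (y - z) = Sform A w w.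
  by rewrite /w -opprB SformNl SformNr opprK.
have Ex : E (x, c x).
  apply: epi_maximal_mem => // y' r' Ey'.
  have := strong _ Ey'; rewrite /phi /Q /= => h.
  (* In the lower bound on r' given by [strong] the terms quadratic in [y'] cancel. Its slope is
     S(x, .), since [x] was reflected so that A x = A (2z - y) and B x = B y. *)
  suff : Sform S x y' - c x <= m + Sform A (y' - y) (y' - y) / 2 +
     Sform B (y' - y) (y' - y) / 2 + c y' - Sform A (y' - z) (y' - z) by lra.
  rewrite SE !SformBm !AxE !BxE (SformC y x symA) (SformC y x symB).
  rewrite (SformC w x symA) !AxE !BxE.
  have := A_ge0 w; move: Ayz; rewrite yzw /w.
  rewrite !(SformDl, SformDr, SformNl, SformNr).
  rewrite (SformC y y' symA) (SformC y y' symB) (SformC z y' symA) (SformC z y symA).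
  lra.
have Aw : Sform A (x - z) (x - z) = Sform A w w.
  rewrite !(SformDl, SformDr, SformNl, SformNr) AxE (SformC y x symA) (SformC w x symA).
  rewrite (SformC z x symA) !AxE /w.
  rewrite !(SformDl, SformDr, SformNl, SformNr) (SformC z y symA).
  lra.
exists x => //; rewrite Aw.
(* Growth at the contact point reads m + 2 A(w,w) <= A(w,w), while m >= A(w,w) by [Ayz]; hence
   A(w,w) = 0. *)
have := strong _ Ex; rewrite /phi /= subrr add0r Aw.
have -> : Q (x - y) = 4 * Sform A w w.
  have -> : x - y = 2 *: (w *m Pi : V) by rewrite xE addrAC subrr add0r.
  rewrite /Q !SformZl !SformZr Sform_mulPi_l SformB_mulPi_l.
  by rewrite (SformC _ (w *m Pi) symA) Sform_mulPi_l; ring.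
have := A_ge0 w; move: Ayz; rewrite yzw; lra.
Qed.

(** The set is the contact set of a maximal [E]. If z is monotonically related to it, the contact
    point x with A(x-z,x-z) = 0 has S(x-z,x-z) = - B(x-z,x-z) >= 0, so x = z. The first two
    conclusions serve strong duality, the last two the projection onto a given set. *)
Lemma exists_maxSmonotone_below E0 : E0 !=set0 -> epi_convex E0 -> epi_above E0 ->
  exists G : set V, [/\ maxSmonotone S G,
    forall x y r, G x -> E0 (y, r) -> Sform S x y - c x <= r,
    forall x, E0 (x, c x) -> G x &
    forall z, exists2 x, G x & Sform A (x - z) (x - z) = 0].
Proof.
move=> E0n cE0 aE0; have [E [E0E cE aE mE]] := exists_epi_maximal E0n cE0 aE0.
have En : E !=set0 by case: E0n => e /E0E Ee; exists e.
pose G : set V := [set x | E (x, c x)].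
have touch x y r : G x -> E (y, r) -> Sform S x y - c x <= r by exact: epi_touch.
have proj z : exists2 x, G x & Sform A (x - z) (x - z) = 0.
  exact: epi_maximal_projection.
have monG : Smonotone S G.
  move=> x y Gx Gy; have := touch _ _ _ Gx Gy; have := qform_sub x y.
  by move: (Sform S (x - y) _) (Sform S x y) (c x) (c y) => a b c' d' ; lra.
exists G; split => //; [|by move=> x y r Gx /E0E; exact: touch|by move=> x /E0E].
split => // G' mG' GG'; apply/seteqP; split => // z G'z.
have [x Gx Axz] := proj z; suff -> : z = x by [].
apply/esym/eqP; rewrite -subr_eq0; apply/eqP; apply: sqn0_eq0.
have [K K0 hK] := AB_pos; apply: le_trans (hK _) _.
have := mG' x z (GG' _ Gx) G'z; have := B_ge0 (x - z).
rewrite SE SformBm Axz => h1 h2.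
have -> : Sform B (x - z) (x - z) = 0 by lra.
by rewrite addr0 mulr0.
Qed.

Lemma maxSmonotone_mem G z : maxSmonotone S G ->
  (forall x, G x -> 0 <= Sform S (x - z) (x - z)) -> G z.
Proof.
move=> [mG maxG] hz; have <- : G `|` [set z] = G; last by right.
apply: maxG; last by move=> x; left.
have hN (x y : V) : Sform S (x - y) (x - y) = Sform S (y - x) (y - x).
  by rewrite -opprB SformNl SformNr opprK.
move=> x y [Gx|->] [Gy|->]; [exact: mG|exact: hz|by rewrite hN; exact: hz|].
by rewrite subrr Sform0l.
Qed.

Lemma maxSmonotone_nonempty G : maxSmonotone S G -> G !=set0.
Proof.
move=> mG; apply: contrapT => G0; apply: (G0); exists 0.
by apply: maxSmonotone_mem => // x Gx; exfalso; apply: G0; exists x.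
Qed.

(** [E0] is the epigraph of psi_G. A point below the graph of [c] would be over some y monotonically
    related to [G], hence in [G], where psi_G(y) >= c(y). The contact set obtained from [E0]
    contains [G], so it equals [G]. *)
Lemma maxSmonotone_projection G : maxSmonotone S G ->
  forall z, exists2 x, G x & Sform A (x - z) (x - z) = 0.
Proof.
move=> mG.
pose E0 : set (V * R) := [set e | forall x, G x -> Sform S x e.1 - c x <= e.2].
have GE0 x : G x -> E0 (x, c x).
  move=> Gx x' Gx' /=; have := mG.1 _ _ Gx' Gx; have := qform_sub x' x.
  by move: (Sform S (x' - x) _) (Sform S x' x) (c x) (c x') => a b c' d' ; lra.
have [||y r hy|G' [mG' _ E0G' proj]] := @exists_maxSmonotone_below E0.
- by have [x Gx] := maxSmonotone_nonempty mG; exists (x, c x); exact: GE0.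
- move=> y r y' r' t h h' /andP[t0 t1] x Gx /=.
  have := h _ Gx; have := h' _ Gx; rewrite /= SformDr !SformZr.
  move: (Sform S x y) (Sform S x y') (c x) => a b e; nra.
- rewrite leNgt; apply/negP => ry.
  have Gy : G y.
    apply: maxSmonotone_mem => // x Gx; have := hy x Gx; have := qform_sub x y.
    rewrite /=; move: ry.
    by move: (Sform S (x - y) _) (Sform S x y) (c x) (c y) => a b c' d' ; lra.
  by have := hy y Gy; rewrite /=; lra.
- have -> : G = G'; last exact: proj.
  by apply/esym/mG.2; [exact: mG'.1|move=> x /GE0/E0G'].
Qed.

End Sets.

(** * Borel structure of the space of vectors *)

Lemma bigcup_count_nat (T : Type) (I : countType) (P : set I) (F : I -> set T) :
  \bigcup_(i in P) F i = \bigcup_n (if pickle_inv n is Some i then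
    if `[< P i >] then F i else set0 else set0).
Proof.
apply/seteqP; split => t.
  by move=> [i Pi Fit]; exists (pickle i) => //; rewrite pickleK_inv asboolT.
by move=> [n _]; case: pickle_inv => // i; case: asboolP => // Pi; exists i.
Qed.

Section VecMeasurability.
Variables (R : realType) (d : nat).
Local Notation V := (vec R d).

Lemma nbhs_coordP (x : V) (U : set V) : nbhs x U <->
  exists2 e : R, 0 < e & forall y : V, (forall i, `|coord x i - coord y i| < e) -> U y.
Proof.
split.
  move=> /nbhs_ballP[e /= e0 xU]; exists e => // y xy; apply: xU.
  by split => // i j; rewrite ord1; exact: xy.
move=> [e e0 xU]; apply/nbhs_ballP; exists e => // y xy; apply: xU => i.
exact: (xy.2 0 i).
Qed.

Lemma continuous_coord i : continuous (fun x : V => coord x i).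
Proof. exact: (@coord_continuous R 1 d 0 i). Qed.

Lemma continuous_Sform (M : 'M[R]_d) (T : topologicalType) (f g : T -> V) :
  continuous f -> continuous g -> continuous (fun t => Sform M (f t) (g t)).
Proof.
move=> cf cg t; apply: cvg_Sform => i.
  exact: (cvg_comp _ _ (cf t) (@continuous_coord i _)).
exact: (cvg_comp _ _ (cg t) (@continuous_coord i _)).
Qed.

Lemma open_measurable_vec (U : set V) : open U -> measurable U.
Proof. by move=> oU; exact: sub_sigma_algebra. Qed.

Lemma continuous_measurable_vecr (f : V -> R) : continuous f -> measurable_fun setT f.
Proof.
move=> /continuousP cf; apply: (measurability _ (RGenOpens.measurableE R)).
move=> _ [_ [a [b ->] <-]]; rewrite setTI; apply: open_measurable_vec.
exact/cf/interval_open.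
Qed.

Lemma continuous_measurable_vec (f : V -> V) : continuous f -> measurable_fun setT f.
Proof.
move=> /continuousP cf; apply: (@measurability _ _ _ V _ _ (@open 'rV[R]_d)) => //.
by move=> _ [U oU <-]; rewrite setTI; apply: open_measurable_vec; exact: cf.
Qed.

Lemma measurable_coord i : measurable_fun setT (fun x : V => coord x i).
Proof. by apply: continuous_measurable_vecr; exact: continuous_coord. Qed.

(** Cubes with rational centre and radius 1/(k+1), a countable base of the topology. They reduce
    statements about open sets, dense sequences and null sets to countable unions. *)
Definition ratbox (qk : 'rV[rat]_d * nat) : set V :=
  [set x | forall i, `|coord x i - ratr (qk.1 0 i)| < qk.2.+1%:R^-1].

Lemma open_ratbox qk : open (ratbox qk).
Proof.
rewrite openE => x hx; apply: (@filter_forall V _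
  (fun i => [set y : V | `|coord y i - ratr (qk.1 0 i)| < qk.2.+1%:R^-1]) (nbhs x)) => i.
apply: (@continuous_coord i x [set r | `|r - ratr (qk.1 0 i)| < qk.2.+1%:R^-1]).
have -> : [set r | `|r - ratr (qk.1 0 i)| < qk.2.+1%:R^-1] =
    ball (ratr (qk.1 0 i) : R) qk.2.+1%:R^-1.
  by apply/seteqP; split => r; rewrite /ball /= distrC.
by apply: open_nbhs_nbhs; split; [exact: ball_open|rewrite /ball /= distrC; exact: hx].
Qed.

Lemma ratbox_nbhs (x : V) (U : set V) : nbhs x U ->
  exists2 qk, ratbox qk x & ratbox qk `<=` U.
Proof.
move=> /nbhs_coordP[e e0 xU].
have [k _ ke] : exists2 k : nat, True & k.+1%:R^-1 < e / 2.
  have e2 : 0 < e / 2 by rewrite divr_gt0.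
  have /cvgrPdist_lt/(_ _ e2)[k _ hk] := @cvg_harmonic R.
  by exists k => //; have := hk k (leqnn k); rewrite /= sub0r normrN ger0_norm ?invr_ge0.
have k0 : 0 < (k.+1%:R^-1 : R) by rewrite invr_gt0.
have /choice[q hq] : forall i, exists q : rat, `|coord x i - ratr q| < k.+1%:R^-1.
  move=> i; have lt : coord x i - k.+1%:R^-1 < coord x i + k.+1%:R^-1.
    by move: (k.+1%:R^-1 : R) k0 (coord x i) => a a0 b; lra.
  have [q] := rat_in_itvoo lt; rewrite in_itv /= => /andP[h1 h2].
  by exists q; rewrite ltr_norml; move: h1 h2; move: (_^-1) => a; lra.
exists (\row_i q i, k) => [i|y hy]; rewrite /=; first by rewrite mxE.
apply: xU => i; have := hq i; have := hy i; rewrite /= mxE !ltr_norml.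
move: ke k0; move: (_^-1) (coord x i) (coord y i) => a b c; lra.
Qed.

Lemma bigcup_countT_measurable d' (T : measurableType d') (I : countType) (P : set I)
    (F : I -> set T) :
  (forall i, P i -> measurable (F i)) -> measurable (\bigcup_(i in P) F i).
Proof.
move=> mF; rewrite bigcup_count_nat; apply: bigcupT_measurable => n.
by case: pickle_inv => // i; case: asboolP => // Pi; exact: mF.
Qed.

(** Every open set is a countable union of rational boxes, and a box is a finite intersection of
    conditions on coordinates. *)
Lemma measurable_fun_vec d' (T : measurableType d') (f : T -> V) :
  (forall i, measurable_fun setT (fun t => coord (f t) i)) -> measurable_fun setT f.
Proof.
move=> mf; apply: (@measurability _ _ _ V _ _ (@open 'rV[R]_d)) => //.
move=> _ [U oU <-]; rewrite setTI.
have -> : f @^-1` U = \bigcup_(qk in [set qk | ratbox qk `<=` U]) (f @^-1` ratbox qk).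
  apply/seteqP; split => t /=.
    by move=> /oU Ut; have [qk tqk qkU] := ratbox_nbhs Ut; exists qk.
  by move=> [qk qkU tqk]; exact: qkU.
apply: bigcup_countT_measurable => qk _.
have -> : f @^-1` ratbox qk = \bigcap_(i in [set: 'I_d])
    (fun t => coord (f t) i) @^-1` ball (ratr (qk.1 0 i) : R) qk.2.+1%:R^-1.
  apply/seteqP; split => x /=.
    by move=> h i _ /=; rewrite /ball /= distrC.
  by move=> h i; have := h i; rewrite /ball /= distrC; apply.
apply: fin_bigcap_measurable => // i _.
rewrite -[X in measurable X]setTI; apply: mf => //; exact: measurable_ball.
Qed.

Lemma measurable_Sform (M : 'M[R]_d) d' (T : measurableType d') (f g : T -> V) :
  measurable_fun setT f -> measurable_fun setT g ->
  measurable_fun setT (fun t => Sform M (f t) (g t)).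
Proof.
move=> mf mg; under eq_fun do rewrite Sform_coord.
apply: measurable_sum => i; apply: measurable_sum => j.
apply: measurable_funM => //; apply: measurable_funM.
  exact: measurableT_comp (@measurable_coord i) mf.
exact: measurableT_comp (@measurable_coord j) mg.
Qed.

Lemma measurable_sqn d' (T : measurableType d') (f : T -> V) :
  measurable_fun setT f -> measurable_fun setT (fun t => sqn (f t)).
Proof.
by move=> mf; under eq_fun do rewrite sqn_Sform; exact: measurable_Sform.
Qed.

End VecMeasurability.

(** * Densities, conditional expectations and mixtures *)

Section Density.
Context dT (T : measurableType dT) (R : realType).
Variables (mu : {finite_measure set T -> \bar R}) (w : T -> R).
Hypothesis w_ge0 : forall x, 0 <= w x.
Hypothesis intw : mu.-integrable setT (EFin \o w).

Let dens (A : set T) := (\int[mu]_(x in A) (w x)%:E)%E.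

Let dens0 : dens set0 = 0%E.
Proof. exact: integral_set0. Qed.

Let dens_ge0 A : (0 <= dens A)%E.
Proof. by apply: integral_ge0 => x _; rewrite lee_fin. Qed.

Let mw : measurable_fun setT (EFin \o w).
Proof. exact: measurable_int intw. Qed.

Let dens_sigma_additive : semi_sigma_additive dens.
Proof.
move=> F mF tF mUF; rewrite /dens ge0_integral_bigcup//; last 2 first.
- exact: measurable_funTS.
- by move=> x _; rewrite lee_fin.
by apply: is_cvg_ereal_nneg_natsum => n _; exact: dens_ge0.
Qed.

HB.instance Definition _ := isMeasure.Build _ _ _ dens
  dens0 dens_ge0 dens_sigma_additive.

Let dens_fin : fin_num_fun dens.
Proof. by apply: lty_fin_num_fun; exact: integrable_lty. Qed.

HB.instance Definition _ := @Measure_isFinite.Build _ _ _ dens dens_fin.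

Let dens_dominated : dens `<< mu.
Proof.
apply/null_content_dominatesP => A mA muA0; rewrite /dens.
by apply: null_set_integral => //; exact: measurable_funTS.
Qed.

(** The change of variables holds for the Radon-Nikodym derivative of [dens], which agrees almost
    everywhere with [w] because both have the same integrals over measurable sets. *)
Lemma exists_density : exists nu : {finite_measure set T -> \bar R},
  (forall A, measurable A -> nu A = \int[mu]_(x in A) (w x)%:E)%E /\
  (forall f, (forall x, 0 <= f x)%E -> measurable_fun setT f ->
    \int[nu]_x f x = \int[mu]_x (f x * (w x)%:E))%E.
Proof.
exists dens; split => // f f0 mf.
rewrite -(Radon_Nikodym_SigmaFinite.change_of_variables dens_dominated)//.
have mRN := measurable_int _ (Radon_Nikodym_SigmaFinite.f_integrable dens_dominated).
apply: ae_eq_integral => //; [exact: emeasurable_funM|exact: emeasurable_funM|].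
apply: ae_eqe_mul2l; apply: integral_ae_eq => //.
  exact: Radon_Nikodym_SigmaFinite.f_integrable.
by move=> E _ mE; rewrite -(Radon_Nikodym_SigmaFinite.f_integral dens_dominated mE).
Qed.

End Density.

Section Pushforward.
Context dT dU (T : measurableType dT) (U : measurableType dU) (R : realType).
Variable X : T -> U.
Hypothesis mX : measurable_fun setT X.

Lemma exists_pushforward (mu : {finite_measure set T -> \bar R}) :
  exists nu : {finite_measure set U -> \bar R},
  (forall A, nu A = mu (X @^-1` A)) /\
  (forall A f, (forall x, 0 <= f x)%E -> measurable A -> measurable_fun setT f ->
    \int[nu]_(x in A) f x = \int[mu]_(x in X @^-1` A) f (X x))%E.
Proof.
pose m := measure_function_pushforward__canonical__measure_function_Measure mu mX.
have finm : fin_num_fun m.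
  apply: lty_fin_num_fun; rewrite /= /pushforward.
  by rewrite preimage_setT ltey_eq fin_num_measure.
pose m' : {finite_measure set U -> \bar R} :=
  HB.pack (m : set U -> \bar R) (Measure.class m) (@Measure_isFinite.Build _ _ _ m finm).
exists m'; split => // A f f0 mA mf.
by rewrite ge0_integral_pushforward//; exact: measurable_funTS.
Qed.

(** The image under [X] of the measure with density [phi] is at most [C] times the image of [mu];
    [F] is its Radon-Nikodym derivative. *)
Lemma exists_conditional_expectation (mu : {finite_measure set T -> \bar R})
    (phi : T -> R) (C : R) :
  measurable_fun setT phi -> (forall x, 0 <= phi x <= C) ->
  exists F : U -> R, [/\ measurable_fun setT F, (forall u, 0 <= F u <= C) &
    forall A, measurable A -> (\int[mu]_(x in X @^-1` A) (phi x)%:E =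
      \int[mu]_(x in X @^-1` A) (F (X x))%:E)%E].
Proof.
move=> mphi phiC; have phi0 x : 0 <= phi x by have /andP[] := phiC x.
have intphi : mu.-integrable setT (EFin \o phi).
  apply: measurable_bounded_integrable => //.
    by rewrite ltey_eq fin_num_measure.
  exists C; split; first exact: num_real.
  move=> M CM x _ /=; have /andP[h1 h2] := phiC x.
  by rewrite ger0_norm// (le_trans h2)// ltW.
have [nu [nuE _]] := exists_density phi0 intphi.
have [nu' [nu'E _]] := exists_pushforward nu.
have [mu' [mu'E intmu']] := exists_pushforward mu.
have mXA A : measurable A -> measurable (X @^-1` A).
  by move=> mA; rewrite -[X in measurable X]setTI; exact: mX.
have nu'_le A : measurable A -> (nu' A <= C%:E * mu' A)%E.
  move=> mA; rewrite nu'E nuE ?mu'E; last exact: mXA.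
  rewrite -integral_cst ?mu'E; last exact: mXA.
  apply: ge0_le_integral => //=.
  - exact: mXA.
  - by move=> x _; rewrite lee_fin.
  - by apply/measurable_EFinP; exact: measurable_funTS.
  - by move=> x _; rewrite lee_fin; have /andP[] := phiC x.
have dom : nu' `<< mu'.
  apply/null_content_dominatesP => A mA muA0; apply/eqP; rewrite eq_le measure_ge0 andbT.
  by rewrite (le_trans (nu'_le _ mA))// muA0 mule0.
have [f [f0 fint fE]] := radon_nikodym_finite dom.
have mf := measurable_int _ fint.
pose N := [set u | C%:E < f u]%E.
have mN : measurable N.
  by rewrite -[N]setTI; apply: emeasurable_fun_o_infty.
have N0 : mu'.-negligible N.
  have : ae_eq mu' N f (cst C%:E).
    apply: integral_ae_eq => //; first exact: integrableS fint.
    move=> E EN mE; rewrite -fE//; apply/eqP; rewrite eq_le.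
    rewrite integral_cst// nu'_le//= fE// -integral_cst//.
    apply: ge0_le_integral => //.
    - by move=> x /EN; rewrite /N /= => _;
        rewrite lee_fin (le_trans (phi0 point))//; have /andP[] := phiC point.
    - exact: measurable_funTS.
    - by move=> x /EN /ltW.
  case=> M [mM M0 hM]; exists M; split => // x Nx; apply: hM => /=.
  by move=> /(_ Nx) fx; move: Nx; rewrite /N /= fx ltxx.
(* The derivative exceeds [C] only on the null set [N]; truncation makes it real and bounded
   everywhere. *)
pose F u := fine (Order.min (f u) C%:E).
have FE u : (F u)%:E = Order.min (f u) C%:E.
  rewrite /F fineK// fin_numElt; apply/andP; split.
    by rewrite lt_min ltNyr andbT (lt_le_trans _ (f0 u)).
  by rewrite gt_min ltry orbT.
have mF : measurable_fun setT F.
  apply/measurable_EFinP; have -> : EFin \o F = fun u => Order.min (f u) C%:E.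
    by apply/funext => u; exact: FE.
  exact: measurable_mine.
exists F; split => // [u|A mA].
  rewrite -!lee_fin FE ge_min lexx orbT andbT le_min f0/= lee_fin.
  by rewrite (le_trans (phi0 point))//; have /andP[] := phiC point.
have F0 u : (0 <= (F u)%:E)%E.
  by rewrite FE le_min f0 lee_fin (le_trans (phi0 point))//; have /andP[] := phiC point.
rewrite -nuE; last exact: mXA.
rewrite -nu'E fE// -(intmu' A (EFin \o F))//; last exact/measurable_EFinP.
apply: ge0_ae_eq_integral => //; [exact: measurable_funTS| |by move=> u _; exact: F0|].
  by apply/measurable_EFinP; exact: measurable_funTS.
case: N0 => M [mM M0 NM]; exists M; split => // u; rewrite /= => hu; apply: NM.
rewrite /N /= ltNge; apply/negP => fuC; apply: hu => _.
by rewrite /= FE; apply/esym/min_idPl.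
Qed.

Lemma integrable_dominated (mu : {measure set T -> \bar R}) (f g : T -> R) :
  measurable_fun setT f -> (forall x, `|f x| <= g x) ->
  mu.-integrable setT (EFin \o g) -> mu.-integrable setT (EFin \o f).
Proof.
move=> mf fg; apply: le_integrable => //; first exact/measurable_EFinP.
by move=> x _ /=; rewrite lee_fin (le_trans (fg x))// ler_norm.
Qed.

(* The densities given by the positive and negative parts of [phi] have the same
   image under [X]. *)
Lemma integral_comp_mul_eq0 (mu : {finite_measure set T -> \bar R})
    (phi : T -> R) (h : U -> R) :
  mu.-integrable setT (EFin \o phi) ->
  (forall A, measurable A -> \int[mu]_(x in X @^-1` A) (phi x)%:E = 0)%E ->
  measurable_fun setT h ->
  mu.-integrable setT (fun x => (h (X x) * phi x)%:E) ->
  \int[mu]_x (h (X x) * phi x) = 0.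
Proof.
move=> iphi phi0 mh ihphi.
have mphi : measurable_fun setT phi by apply/measurable_EFinP; exact: measurable_int iphi.
have mhX : measurable_fun setT (h \o X) by exact: measurableT_comp.
pose pos (r : R) := Num.max r 0; pose neg (r : R) := Num.max (- r) 0.
have pos0 r : 0 <= pos r by rewrite le_max lexx orbT.
have neg0 r : 0 <= neg r by rewrite le_max lexx orbT.
have posneg r : r = pos r - neg r.
  by rewrite /pos /neg; case: (ltP r 0) => h1; case: (ltP (- r) 0) => h2; lra.
have pos_le r : pos r <= `|r| by rewrite ge_max ler_norm normr_ge0.
have neg_le r : neg r <= `|r| by rewrite ge_max -normrN ler_norm normr_ge0.
have mpos dV (V : measurableType dV) (f : V -> R) :
    measurable_fun setT f -> measurable_fun setT (pos \o f).
  by move=> mf; apply: measurable_maxr.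
have mneg dV (V : measurableType dV) (f : V -> R) :
    measurable_fun setT f -> measurable_fun setT (neg \o f).
  by move=> mf; apply: measurable_maxr => //; exact: measurable_funN.
have iabs := integrable_norm iphi.
have ipos : mu.-integrable setT (EFin \o (pos \o phi)).
  by apply: integrable_dominated iabs; [exact: mpos|move=> x /=; rewrite ger0_norm].
have ineg : mu.-integrable setT (EFin \o (neg \o phi)).
  by apply: integrable_dominated iabs; [exact: mneg|move=> x /=; rewrite ger0_norm].
have [na [naE intna]] := exists_density (fun x => pos0 (phi x)) ipos.
have [nb [nbE intnb]] := exists_density (fun x => neg0 (phi x)) ineg.
have [na' [na'E intna']] := exists_pushforward na.
have [nb' [nb'E intnb']] := exists_pushforward nb.
have nab A : measurable A -> na' A = nb' A.
  move=> mA; have mXA : measurable (X @^-1` A).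
    by rewrite -[X in measurable X]setTI; exact: mX.
  rewrite na'E nb'E naE// nbE//.
  have i1 : mu.-integrable (X @^-1` A) (EFin \o (pos \o phi)) by exact: integrableS ipos.
  have i2 : mu.-integrable (X @^-1` A) (EFin \o (neg \o phi)) by exact: integrableS ineg.
  have := integralB mXA i1 i2.
  rewrite (_ : integral _ _ (_ \- _)%E = 0%E); last first.
    rewrite -[RHS](phi0 A mA); apply: eq_integral => x _.
    by rewrite /= -EFinB -posneg.
  rewrite -(fineK (integrable_fin_num mXA i1)) -(fineK (integrable_fin_num mXA i2)).
  by rewrite -EFinB => /esym[/eqP]; rewrite subr_eq0 => /eqP ->.
have key (k : U -> R) : measurable_fun setT k -> (forall u, 0 <= k u) ->
    \int[mu]_x (k (X x) * pos (phi x)) = \int[mu]_x (k (X x) * neg (phi x)).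
  move=> mk k0; rewrite /Rintegral; congr fine.
  have mkX : measurable_fun setT (fun x => (k (X x))%:E).
    by apply/measurable_EFinP; exact: (measurableT_comp mk mX).
  under eq_integral do rewrite EFinM.
  rewrite -(intna (fun x => (k (X x))%:E))//; last by move=> x; rewrite lee_fin.
  under [RHS]eq_integral do rewrite EFinM.
  rewrite -(intnb (fun x => (k (X x))%:E))//; last by move=> x; rewrite lee_fin.
  have k0' u : (0 <= (k u)%:E)%E by rewrite lee_fin.
  have mk' : measurable_fun setT (EFin \o k) by exact/measurable_EFinP.
  have := intna' setT (EFin \o k) k0' measurableT mk'; rewrite preimage_setT /= => <-.
  have := intnb' setT (EFin \o k) k0' measurableT mk'; rewrite preimage_setT /= => <-.
  by apply: eq_measure_integral => A mA _; exact: nab.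
have iabs2 := integrable_norm ihphi.
have ikey (k : R -> R) (l : R -> R) : (forall r, 0 <= k r) -> (forall r, k r <= `|r|) ->
    (forall r, 0 <= l r) -> (forall r, l r <= `|r|) ->
    measurable_fun setT (k \o (h \o X)) -> measurable_fun setT (l \o phi) ->
    mu.-integrable setT (EFin \o (fun x => k (h (X x)) * l (phi x))).
  move=> k0 kle l0 lle mk ml; apply: integrable_dominated iabs2.
    exact: measurable_funM.
  by move=> x; rewrite /= ger0_norm ?mulr_ge0// normrM ler_pM.
have i1 := ikey pos pos pos0 pos_le pos0 pos_le (mpos _ _ _ mhX) (mpos _ _ _ mphi).
have i2 := ikey pos neg pos0 pos_le neg0 neg_le (mpos _ _ _ mhX) (mneg _ _ _ mphi).
have i3 := ikey neg pos neg0 neg_le pos0 pos_le (mneg _ _ _ mhX) (mpos _ _ _ mphi).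
have i4 := ikey neg neg neg0 neg_le neg0 neg_le (mneg _ _ _ mhX) (mneg _ _ _ mphi).
transitivity (\int[mu]_x ((pos (h (X x)) * pos (phi x) - pos (h (X x)) * neg (phi x)) -
    (neg (h (X x)) * pos (phi x) - neg (h (X x)) * neg (phi x)))).
  apply: eq_Rintegral => x _; rewrite {1}(posneg (h (X x))) {1}(posneg (phi x)); ring.
have i12 := integrableB measurableT i1 i2; have i34 := integrableB measurableT i3 i4.
have /= k1 := key (pos \o h) (mpos _ _ _ mh) (fun u => pos0 (h u)).
have /= k2 := key (neg \o h) (mneg _ _ _ mh) (fun u => neg0 (h u)).
by rewrite RintegralB// !RintegralB// k1 k2 !subrr.
Qed.

End Pushforward.

(** Each x sends the fraction [w x] of its mass to [T1 x] and the rest to [T0 x]: the law is a sum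
    of two pushed-forward densities. *)
Lemma exists_mixture dT (T : measurableType dT) dU (U : measurableType dU) (R : realType)
    (P : probability T R) (w : T -> R) (T0 T1 : T -> U) :
  measurable_fun setT w -> (forall x, 0 <= w x <= 1) ->
  measurable_fun setT T0 -> measurable_fun setT T1 ->
  exists Q : probability U R, forall f : U -> \bar R, (forall x, 0 <= f x)%E ->
    measurable_fun setT f ->
    (\int[Q]_u f u = \int[P]_x (f (T1 x) * (w x)%:E + f (T0 x) * (1 - w x)%:E))%E.
Proof.
move=> mw w01 mT0 mT1.
have w0 x : 0 <= w x by have /andP[] := w01 x.
have w1 x : 0 <= 1 - w x by have /andP[_] := w01 x; rewrite subr_ge0.
have mw1 : measurable_fun setT (fun x => 1 - w x) by exact: measurable_funB.
have int1 : P.-integrable setT (EFin \o cst 1) by exact: finite_measure_integrable_cst.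
have iw : P.-integrable setT (EFin \o w).
  apply: integrable_dominated int1 => // x; rewrite ger0_norm//=.
  by have /andP[] := w01 x.
have iw1 : P.-integrable setT (EFin \o (fun x => 1 - w x)).
  by apply: integrable_dominated int1 => // x; rewrite ger0_norm//= gerBl.
have [nu1 [nu1E intnu1]] := exists_density w0 iw.
have [nu0 [nu0E intnu0]] := exists_density w1 iw1.
have [m1 [m1E intm1]] := exists_pushforward mT1 nu1.
have [m0 [m0E intm0]] := exists_pushforward mT0 nu0.
have add1 : (measure_add m1 m0 setT = 1)%E.
  have -> : (measure_add m1 m0 setT = m1 setT + m0 setT)%E by rewrite measure_addE.
  rewrite m1E m0E !preimage_setT nu1E// nu0E// -ge0_integralD//.
  - under eq_integral do rewrite -EFinD addrC subrK.
    by rewrite integral_cst// mul1e; exact: probability_setT.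
  - by move=> x _; rewrite lee_fin.
  - exact/measurable_EFinP.
  - by move=> x _; rewrite lee_fin.
  - exact/measurable_EFinP.
pose Q : probability U R := HB.pack (measure_add m1 m0 : set U -> \bar R)
  (Measure.class (measure_add m1 m0)) (Measure_isProbability.Build _ _ _
    (measure_add m1 m0) add1).
exists Q => f f0 mf; rewrite ge0_integral_measure_add//.
rewrite intm1// intm0// !preimage_setT.
rewrite (intnu1 (fun x => f (T1 x)))//; last exact: measurableT_comp.
rewrite (intnu0 (fun x => f (T0 x)))//; last exact: measurableT_comp.
rewrite -ge0_integralD//.
- by move=> x _; rewrite mule_ge0// lee_fin.
- apply: emeasurable_funM; first exact: measurableT_comp.
  exact/measurable_EFinP.
- by move=> x _; rewrite mule_ge0// lee_fin.
- apply: emeasurable_funM; first exact: measurableT_comp.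
  exact/measurable_EFinP.
Qed.

Section WeightedConditionalExpectation.
Context dT dU (T : measurableType dT) (U : measurableType dU) (R : realType).
Variables (P : probability T R) (X : T -> U).
Hypothesis mX : measurable_fun setT X.

Lemma bounded_integrable (mu : {finite_measure set T -> \bar R}) (f : T -> R) (C : R) :
  measurable_fun setT f -> (forall x, `|f x| <= C) -> mu.-integrable setT (EFin \o f).
Proof.
move=> mf fC; apply: (@integrable_dominated _ _ _ _ f (cst C)) => //.
exact: finite_measure_integrable_cst.
Qed.

(** [f (X)] is E[th | X] / E[v | X], obtained as the conditional expectation of th / v under the
    measure with density [v]. *)
Lemma exists_weighted_conditional_expectation (v th : T -> R) (C : R) :
  measurable_fun setT v -> (forall x, 2^-1 <= v x <= 1) ->
  measurable_fun setT th -> (forall x, `|th x| <= C) ->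
  exists f : U -> R, [/\ measurable_fun setT f, (forall u, `|f u| <= 2 * C) &
    forall A, measurable A ->
      (\int[P]_(x in X @^-1` A) (th x - v x * f (X x))%:E = 0)%E].
Proof.
move=> mv v01 mth thC.
have C0 : 0 <= C by apply: le_trans (thC point).
have v0 x : 0 < v x by have := v01 x; lra.
have v1 x : `|v x| <= 1.
  by rewrite ger0_norm; [have := v01 x; lra|exact: ltW].
have iv : P.-integrable setT (EFin \o v) by exact: bounded_integrable v1.
have [mu [_ intmu]] := exists_density (fun x => ltW (v0 x)) iv.
(* As v >= 1/2, |th / v| <= 2 C; the shift makes [phi] nonnegative, with values in [0, 4 C]. *)
pose phi x := th x * (v x)^-1 + 2 * C.
have mphi : measurable_fun setT phi.
  apply: measurable_funD => //; apply: measurable_funM => //.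
  rewrite (_ : (fun x => _) = (fun x => v x `^ (-1))).
    exact: (measurableT_comp (@measurable_powR R (-1)) mv).
  by apply/funext => x; rewrite powR_inv1// ltW.
have phiC x : 0 <= phi x <= 4 * C.
  have vi : (v x)^-1 <= 2.
    rewrite -[leRHS]invrK lef_pV2 ?posrE ?invr_gt0//.
    by have := v01 x; lra.
  have : `|th x * (v x)^-1| <= C * 2.
    rewrite normrM ler_pM// ger0_norm// invr_ge0; exact: ltW.
  by rewrite /phi ler_norml; lra.
have [F [mF FC FE]] := exists_conditional_expectation mX mu mphi phiC.
exists (fun u => F u - 2 * C); split.
- exact: measurable_funB.
- by move=> u; have := FC u; rewrite ler_norml; lra.
move=> A mA.
have mXA : measurable (X @^-1` A) by rewrite -[X in measurable X]setTI; exact: mX.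
have conv (k : T -> R) : measurable_fun setT k -> (forall x, 0 <= k x) ->
    (\int[mu]_(x in X @^-1` A) (k x)%:E = \int[P]_(x in X @^-1` A) (k x * v x)%:E)%E.
  move=> mk k0; rewrite integral_mkcond [RHS]integral_mkcond intmu.
  - apply: eq_integral => x _; rewrite /= !patchE; case: ifP => _.
      by rewrite EFinM.
    by rewrite mul0e.
  - by move=> x; rewrite patchE; case: ifP => // _; rewrite lee_fin.
  - apply/(measurable_restrictT _ mXA)/measurable_EFinP.
    exact: measurable_funTS.
have := FE A mA; rewrite conv//; last by move=> x; have /andP[] := phiC x.
rewrite conv; last 2 first.
- exact: (measurableT_comp mF mX).
- by move=> x; have /andP[] := FC (X x).
have b1 : P.-integrable (X @^-1` A) (EFin \o (fun x => phi x * v x)).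
  apply: (integrableS measurableT mXA (@subsetT _ _)).
  apply: (@bounded_integrable _ _ (4 * C * 1)); first exact: measurable_funM.
  by move=> x; rewrite normrM ler_pM// ger0_norm; have /andP[] := phiC x.
have b2 : P.-integrable (X @^-1` A) (EFin \o (fun x => F (X x) * v x)).
  apply: (integrableS measurableT mXA (@subsetT _ _)).
  apply: (@bounded_integrable _ _ (4 * C * 1)).
    by apply: measurable_funM => //; exact: (measurableT_comp mF mX).
  by move=> x; rewrite normrM ler_pM// ger0_norm; have /andP[] := FC (X x).
move=> eqF; have := integralB mXA b1 b2.
rewrite eqF subee; last exact: (integrable_fin_num mXA b2).
move=> <-; apply: eq_integral => x _; rewrite /= -EFinB; congr EFin.
by rewrite /phi; field; exact: lt0r_neq0.
Qed.

End WeightedConditionalExpectation.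

(** The identity for nonnegative functions is applied to the absolute value of [f] for
    integrability, then to its positive and negative parts for the value. *)
Lemma mixture_Rintegral dT (T : measurableType dT) dU (U : measurableType dU)
    (R : realType) (P : probability T R) (Q : probability U R) (w : T -> R)
    (T0 T1 : T -> U) (f : U -> R) :
  measurable_fun setT w -> (forall x, 0 <= w x <= 1) ->
  measurable_fun setT T0 -> measurable_fun setT T1 ->
  (forall f : U -> \bar R, (forall x, 0 <= f x)%E -> measurable_fun setT f ->
    (\int[Q]_u f u = \int[P]_x (f (T1 x) * (w x)%:E + f (T0 x) * (1 - w x)%:E))%E) ->
  measurable_fun setT f ->
  P.-integrable setT (EFin \o (f \o T0)) -> P.-integrable setT (EFin \o (f \o T1)) ->
  Q.-integrable setT (EFin \o f) /\
  \int[Q]_u f u = \int[P]_x (w x * f (T1 x) + (1 - w x) * f (T0 x)).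
Proof.
move=> mw w01 mT0 mT1 QE mf i0 i1.
have w0 x : 0 <= w x by have := w01 x; lra.
have w1 x : 0 <= 1 - w x by have := w01 x; lra.
have mfT0 : measurable_fun setT (f \o T0) by exact: measurableT_comp.
have mfT1 : measurable_fun setT (f \o T1) by exact: measurableT_comp.
have mw1 : measurable_fun setT (fun x => 1 - w x) by exact: measurable_funB.
pose G (k : R -> R) x := w x * k (f (T1 x)) + (1 - w x) * k (f (T0 x)).
have iG (k : R -> R) : measurable_fun setT k -> (forall r, `|k r| <= `|r|) ->
    P.-integrable setT (EFin \o G k).
  move=> mk kle.
  have j0 := integrable_norm i0; have j1 := integrable_norm i1.
  apply: (@integrable_dominated _ _ _ _ _
    (fun x => `|(f \o T0) x| + `|(f \o T1) x|)).
  - apply: measurable_funD; apply: measurable_funM => //.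
      exact: (measurableT_comp mk mfT1).
    exact: (measurableT_comp mk mfT0).
  - move=> x; rewrite /G (le_trans (ler_normD _ _))// addrC lerD// normrM.
      by rewrite -[leRHS]mul1r ler_pM// ger0_norm// gerBl.
    by rewrite -[leRHS]mul1r ler_pM// ger0_norm//; have /andP[] := w01 x.
  - exact: (integrableD measurableT j0 j1).
have QG (k : R -> R) : measurable_fun setT k -> (forall r, 0 <= k r) ->
    (forall r, `|k r| <= `|r|) -> (\int[Q]_u (k (f u))%:E = \int[P]_x (G k x)%:E)%E.
  move=> mk k0 _; rewrite (QE (fun u => (k (f u))%:E)).
  - by apply: eq_integral => x _; rewrite -!EFinM -EFinD /G; congr EFin; ring.
  - by move=> x; rewrite lee_fin.
  - by apply/measurable_EFinP; exact: (measurableT_comp mk mf).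
have mn : measurable_fun setT (Num.norm : R -> R) by exact: normr_measurable.
have iQ : Q.-integrable setT (EFin \o f).
  apply/integrableP; split; first exact/measurable_EFinP.
  rewrite (_ : (\int[Q]_x _)%E = (\int[P]_x (G Num.norm x)%:E)%E).
    by apply: integrable_lty => //; apply: iG => // r; rewrite normr_id.
  by rewrite -QG// => r; rewrite normr_id.
split => //.
pose pos (r : R) := Num.max r 0; pose neg (r : R) := Num.max (- r) 0.
have pos0 r : 0 <= pos r by rewrite le_max lexx orbT.
have neg0 r : 0 <= neg r by rewrite le_max lexx orbT.
have posneg r : r = pos r - neg r.
  by rewrite /pos /neg; case: (ltP r 0) => h1; case: (ltP (- r) 0) => h2; lra.
have pos_le r : `|pos r| <= `|r| by rewrite ger0_norm// ge_max ler_norm normr_ge0.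
have neg_le r : `|neg r| <= `|r| by rewrite ger0_norm// ge_max -normrN ler_norm normr_ge0.
have mpos : measurable_fun setT pos by apply: measurable_maxr.
have mneg : measurable_fun setT neg.
  by apply: measurable_maxr => //; exact: measurable_funN.
have iQk (k : R -> R) : measurable_fun setT k -> (forall r, `|k r| <= `|r|) ->
    Q.-integrable setT (EFin \o (fun u => k (f u))).
  move=> mk kle; apply: integrable_dominated (integrable_norm iQ).
    exact: (measurableT_comp mk mf).
  by move=> u; exact: kle.
transitivity (\int[Q]_u (pos (f u) - neg (f u))).
  by apply: eq_Rintegral => u _; exact: posneg.
rewrite RintegralB//; [|exact: iQk..].
rewrite /Rintegral !QG// -!/(Rintegral _ _ _) -RintegralB//; [|exact: iG..].
apply: eq_Rintegral => x _; rewrite /G {3}(posneg (f (T1 x))) {3}(posneg (f (T0 x))).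
ring.
Qed.

(** * The projection onto a maximal monotone set along the negative directions *)

Section ProjectionMap.
Variables (R : realType) (d : nat) (S A B : 'M[R]_d) (K : R) (G : set (vec R d)).
Local Notation V := (vec R d).
Hypotheses (symA : A^T = A) (SE : S = A - B).
Hypothesis A_ge0 : forall v : V, 0 <= Sform A v v.
Hypothesis K_ge0 : 0 <= K.
Hypothesis AB_pos : forall v : V, sqn v <= K * (Sform A v v + Sform B v v).
Hypothesis monG : Smonotone S G.
Hypothesis projG : forall z, exists2 x, G x & Sform A (x - z) (x - z) = 0.

Lemma psd_kernel (u v : V) : Sform A u u = 0 -> Sform A u v = 0.
Proof.
move=> u0; apply/eqP; apply: contraTT isT => uv0.
(* The scalar is chosen so that the form takes the value -1. *)
have := A_ge0 (v - ((Sform A v v + 1) / (2 * Sform A u v)) *: u).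
rewrite !(SformDl, SformDr, SformNl, SformNr, SformZl, SformZr) u0 (SformC v u symA).
set t := Sform A v v; set s := Sform A u v.
have -> : t - (t + 1) / (2 * s) * s + (- ((t + 1) / (2 * s) * s) -
   - ((t + 1) / (2 * s) * ((t + 1) / (2 * s) * 0))) = -1 by field.
by rewrite lerNr oppr0 ler10.
Qed.

(** g x - x is in the kernel of [A], so A takes the same value at g x - g x' as at x - x', and
    monotonicity bounds B at g x - g x' by it. Thus any pointwise choice of [g] is Lipschitz, hence
    measurable and of linear growth. *)
Lemma exists_projection_map : exists g : V -> V, [/\ continuous g,
  (forall x, G (g x)), (forall x, Sform A (g x - x) (g x - x) = 0) &
  exists2 L, 0 <= L & forall x, sqn (g x) <= L * (1 + sqn x)].
Proof.
have /choice[g hg] : forall z, exists x, G x /\ Sform A (x - z) (x - z) = 0.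
  by move=> z; have [x] := projG z; exists x.
have Gg x := (hg x).1; have Ag x := (hg x).2.
have AE x x' : Sform A (g x - g x') (g x - g x') = Sform A (x - x') (x - x').
  have k1 v := psd_kernel v (Ag x); have k2 v := psd_kernel v (Ag x').
  have -> : g x - g x' = (g x - x) - (g x' - x') + (x - x').
    by apply/rowP => i; rewrite !mxE; ring.
  move: (g x - x) (g x' - x') (x - x') k1 k2 => a b e k1 k2.
  rewrite !(SformDl, SformDr, SformNl, SformNr) (SformC e a symA) (SformC e b symA).
  by rewrite !k1 !k2; ring.
have [K' K'0 hK'] := Sform_le_sqn A.
have lip x x' : sqn (g x - g x') <= K * (2 * (K' * 2)) * sqn (x - x').
  apply: le_trans (AB_pos _) _; rewrite -mulrA ler_wpM2l//.
  have := monG (Gg x) (Gg x'); rewrite SE SformBm AE => h.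
  have := le_trans (ler_norm _) (hK' (x - x') (x - x')).
  by rewrite -mulrA => h'; move: h h'; lra.
set L := K * _ in lip.
have L0 : 0 <= L by rewrite !mulr_ge0.
exists g; split => //.
  move=> x U /nbhs_coordP[e e0 hU].
  have cx (x' : V) i : coord (x - t) i @[t --> x'] --> coord (x - x') i.
    have cE (t : V) : coord (x - t) i = coord x i - coord t i by rewrite /coord !mxE.
    rewrite (_ : (fun t => _) = (fun t : V => coord x i - coord t i)); last exact/funext.
    have h : continuous (fun t : V => coord x i - coord t i).
      by move=> t; apply: continuousB; [exact: cst_continuous|exact: continuous_coord].
    by rewrite cE; exact: h.
  have ct : continuous (fun x' : V => Sform 1%:M (x - x') (x - x')).
    by move=> x'; exact: (@cvg_Sform _ _ _ (nbhs x') _ _ _ _ _ _ (cx x') (cx x')).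
  have ne : nbhs (Sform 1%:M (x - x) (x - x)) [set r | r < e ^+ 2 / (L + 1)].
    apply: open_nbhs_nbhs; split; first exact: open_lt.
    by rewrite /= subrr Sform0l divr_gt0 ?exprn_gt0// ltr_wpDl.
  have : \forall x' \near x, Sform 1%:M (x - x') (x - x') < e ^+ 2 / (L + 1).
    exact: (ct x _ ne).
  apply: filterS => x'; rewrite -sqn_Sform ltr_pdivlMr ?ltr_wpDl// => hx'.
  apply: hU => i.
  rewrite -(@ltr_pXn2r _ 2)// ?nnegrE ?(ltW e0)// real_normK ?num_real//.
  apply: le_lt_trans hx'; apply: (@le_trans _ _ (sqn (g x - g x'))).
    by apply: le_trans (coord_sqr_le _ i); rewrite /coord !mxE.
  apply: le_trans (lip x x') _; rewrite mulrC ler_wpM2l ?sqn_ge0//.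
  by rewrite lerDl.
exists (2 * L + 2 * sqn (g 0)) => [|x].
  by rewrite addr_ge0// mulr_ge0// sqn_ge0.
have h : sqn (g x) <= 2 * sqn (g x - g 0) + 2 * sqn (g 0).
  rewrite /sqn !mulr_sumr -big_split /=; apply: ler_sum => i _.
  rewrite /coord !mxE; move: (g x 0 i) (g 0 0 i) => a b.
  by have := sqr_ge0 (a - 2 * b); rewrite !expr2; lra.
apply: le_trans h _; have := lip x 0; rewrite subr0.
have := sqn_ge0 x; have := sqn_ge0 (g 0).
move: (sqn (g x - _)) (sqn x) (sqn (g 0)) => a b c; nra.
Qed.

End ProjectionMap.

(** * Functions of quadratic growth and the martingale property *)

Lemma Rintegral_sum dT (T : measurableType dT) (R : realType)
    (mu : {measure set T -> \bar R}) (I : Type) (r : seq I) (f : I -> T -> R) :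
  (forall i, mu.-integrable setT (EFin \o f i)) ->
  \int[mu]_x (\sum_(i <- r) f i x) = \sum_(i <- r) \int[mu]_x f i x.
Proof.
move=> fi; have fsum s : mu.-integrable setT (EFin \o (fun x => \sum_(i <- s) f i x)).
  elim: s => [|i s IHs].
    by under [X in _.-integrable _ (_ \o X)]eq_fun do rewrite big_nil; exact: integrable0.
  under [X in _.-integrable _ (_ \o X)]eq_fun do rewrite big_cons.
  exact: (integrableD measurableT (fi i) IHs).
elim: r => [|i r IHr].
  under eq_Rintegral do rewrite big_nil.
  by rewrite Rintegral_cst// mul0r big_nil.
under eq_Rintegral do rewrite big_cons.
by rewrite RintegralD// IHr big_cons.
Qed.

Section Growth.
Variables (R : realType) (d : nat).
Local Notation V := (vec R d).
Local Notation Z := (V * V)%type.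
Implicit Types (f g : Z -> R) (u v : Z -> V).

(** Integrable under every plan, so [quad_growth] yields integrability for all plans at once.
    [lin_growth] bounds the square, so that a product of two such functions has [quad_growth]. *)
Definition weight (z : Z) : R := 1 + sqn z.1 + sqn z.2.

Definition quad_growth f := measurable_fun setT f /\
  exists2 K : R, 0 <= K & forall z, `|f z| <= K * weight z.
Definition lin_growth f := measurable_fun setT f /\
  exists2 K : R, 0 <= K & forall z, f z ^+ 2 <= K * weight z.
Definition vlin_growth u := forall i, lin_growth (fun z => coord (u z) i).

Lemma weight_ge1 z : 1 <= weight z.
Proof. by rewrite /weight -addrA lerDl addr_ge0// sqn_ge0. Qed.

Lemma quad_growthD f g : quad_growth f -> quad_growth g ->
  quad_growth (fun z => f z + g z).
Proof.
move=> [mf [K K0 fK]] [mg [L L0 gL]]; split; first exact: measurable_funD.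
exists (K + L) => [|z]; first exact: addr_ge0.
by rewrite (le_trans (ler_normD _ _))// mulrDl lerD.
Qed.

Lemma quad_growthZ k f : quad_growth f -> quad_growth (fun z => k * f z).
Proof.
move=> [mf [K K0 fK]]; split; first exact: measurable_funM.
exists (`|k| * K) => [|z]; first exact: mulr_ge0.
by rewrite normrM -mulrA ler_wpM2l.
Qed.

Lemma quad_growthB f g : quad_growth f -> quad_growth g ->
  quad_growth (fun z => f z - g z).
Proof.
move=> qf /(quad_growthZ (-1)) qg; have := quad_growthD qf qg.
by under eq_fun do rewrite mulN1r.
Qed.

Lemma quad_growth_sum (I : Type) (r : seq I) (f : I -> Z -> R) :
  (forall i, quad_growth (f i)) -> quad_growth (fun z => \sum_(i <- r) f i z).
Proof.
move=> qf; elim: r => [|i r IHr].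
  under eq_fun do rewrite big_nil.
  split; first exact: measurable_cst.
  by exists 0 => // z; rewrite normr0 mul0r.
by under eq_fun do rewrite big_cons; exact: quad_growthD.
Qed.

Lemma lin_growthM f g : lin_growth f -> lin_growth g ->
  quad_growth (fun z => f z * g z).
Proof.
move=> [mf [K K0 fK]] [mg [L L0 gL]]; split; first exact: measurable_funM.
exists (K + L) => [|z]; first exact: addr_ge0.
have := fK z; have := gL z; rewrite mulrDl ler_norml.
move: (f z) (g z) (K * _) (L * _) => a b e k h1 h2.
have := sqr_ge0 (a + b); have := sqr_ge0 (a - b); have := sqr_ge0 a; have := sqr_ge0 b.
rewrite !expr2 in h1 h2 *; lra.
Qed.

Lemma lin_growthD f g : lin_growth f -> lin_growth g ->
  lin_growth (fun z => f z + g z).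
Proof.
move=> [mf [K K0 fK]] [mg [L L0 gL]]; split; first exact: measurable_funD.
exists (2 * (K + L)) => [|z]; first by rewrite mulr_ge0// addr_ge0.
have -> : 2 * (K + L) * weight z = 2 * (K * weight z + L * weight z) by ring.
have := fK z; have := gL z.
move: (f z) (g z) (K * _) (L * _) => a b e k h1 h2.
by have := sqr_ge0 (a - b); rewrite !expr2 in h1 h2 *; lra.
Qed.

Lemma lin_growth_bounded f (C : R) : measurable_fun setT f ->
  (forall z, `|f z| <= C) -> lin_growth f.
Proof.
move=> mf fC; split => //; exists (C ^+ 2) => [|z]; first exact: sqr_ge0.
have C0 : 0 <= C by apply: le_trans (fC (0, 0)).
apply: (@le_trans _ _ (C ^+ 2)); last by rewrite ler_peMr ?sqr_ge0// weight_ge1.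
by rewrite -real_normK ?num_real// ler_pXn2r ?nnegrE.
Qed.

Lemma lin_growthMb f g (C : R) : measurable_fun setT f ->
  (forall z, `|f z| <= C) -> lin_growth g -> lin_growth (fun z => f z * g z).
Proof.
move=> mf fC [mg [L L0 gL]]; split; first exact: measurable_funM.
exists (C ^+ 2 * L) => [|z]; first by rewrite mulr_ge0// sqr_ge0.
have C0 : 0 <= C by apply: le_trans (fC (0, 0)).
rewrite exprMn -mulrA ler_pM ?sqr_ge0//.
by rewrite -real_normK ?num_real// ler_pXn2r ?nnegrE.
Qed.

Lemma quad_growthMb f g (C : R) : measurable_fun setT f ->
  (forall z, `|f z| <= C) -> quad_growth g -> quad_growth (fun z => f z * g z).
Proof.
move=> mf fC [mg [L L0 gL]]; split; first exact: measurable_funM.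
have C0 : 0 <= C by apply: le_trans (fC (0, 0)).
exists (C * L) => [|z]; first by rewrite mulr_ge0.
by rewrite normrM -mulrA ler_pM.
Qed.

Lemma lin_growth_quad f : lin_growth f -> quad_growth f.
Proof.
move=> lf; have l1 : lin_growth (cst 1 : Z -> R).
  by apply: (@lin_growth_bounded _ 1) => // z; rewrite normr1.
by have := lin_growthM l1 lf; under eq_fun do rewrite mul1r.
Qed.

Lemma vlin_growth_fst : vlin_growth fst.
Proof.
move=> i; split; first exact: (measurableT_comp (@measurable_coord R d i) measurable_fst).
exists 1 => // z; rewrite mul1r (le_trans (coord_sqr_le _ _))//.
by rewrite /weight -addrA addrCA lerDl addr_ge0// sqn_ge0.
Qed.

Lemma vlin_growth_snd : vlin_growth snd.
Proof.
move=> i; split; first exact: (measurableT_comp (@measurable_coord R d i) measurable_snd).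
exists 1 => // z; rewrite mul1r (le_trans (coord_sqr_le _ _))//.
by rewrite /weight lerDr addr_ge0// sqn_ge0.
Qed.

Lemma vlin_growth_sqn u (K : R) : measurable_fun setT u -> 0 <= K ->
  (forall z, sqn (u z) <= K * weight z) -> vlin_growth u.
Proof.
move=> mu K0 uK i; split; first exact: (measurableT_comp (@measurable_coord R d i) mu).
by exists K => // z; exact: le_trans (coord_sqr_le _ _) (uK z).
Qed.

Lemma vlin_growth_cst (x : V) : vlin_growth (cst x).
Proof. by move=> i; apply: (@lin_growth_bounded _ `|coord x i|). Qed.

Lemma vlin_growthD u v : vlin_growth u -> vlin_growth v ->
  vlin_growth (fun z => u z + v z).
Proof.
move=> lu lv i; rewrite (_ : (fun z => _) = (fun z => coord (u z) i + coord (v z) i)).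
  exact: lin_growthD.
by apply/funext => z; rewrite /coord mxE.
Qed.

Lemma vlin_growthZ f u (C : R) : measurable_fun setT f ->
  (forall z, `|f z| <= C) -> vlin_growth u -> vlin_growth (fun z => f z *: u z).
Proof.
move=> mf fC lu i; rewrite (_ : (fun z => _) = (fun z => f z * coord (u z) i)).
  exact: lin_growthMb fC _.
by apply/funext => z; rewrite /coord mxE.
Qed.

Lemma vlin_growthB u v : vlin_growth u -> vlin_growth v ->
  vlin_growth (fun z => u z - v z).
Proof.
move=> lu lv; have := vlin_growthD lu (@vlin_growthZ (cst (-1)) v 1 _ _ lv).
under [X in vlin_growth X]eq_fun do rewrite scaleN1r.
by apply => //; move=> z; rewrite normrN1.
Qed.

Lemma quad_growth_Sform M u v : vlin_growth u -> vlin_growth v ->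
  quad_growth (fun z => Sform M (u z) (v z)).
Proof.
move=> lu lv; under eq_fun do rewrite Sform_coord.
apply: quad_growth_sum => i; apply: quad_growth_sum => j.
by apply: quad_growthZ; exact: lin_growthM.
Qed.

End Growth.

Section Plans.
Variables (R : realType) (d : nat) (nu : probability (vec R d) R).
Local Notation V := (vec R d).
Local Notation Z := (V * V)%type.
Variable gamma : probability Z R.
Hypothesis Gg : Gamma nu gamma.

Lemma integrable_quad f : quad_growth f -> gamma.-integrable setT (EFin \o f).
Proof.
move=> [mf [K K0 fK]].
have mw : measurable_fun setT (fun z : Z => sqn z.1 + sqn z.2).
  by apply: measurable_funD; apply: measurable_sqn.
have iq : gamma.-integrable setT (EFin \o (fun z : Z => sqn z.1 + sqn z.2)).
  apply/integrableP; split; first exact/measurable_EFinP.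
  under eq_integral do rewrite /= ger0_norm ?addr_ge0 ?sqn_ge0//.
  exact: Gg.1.
have i1 : gamma.-integrable setT (EFin \o cst 1).
  exact: finite_measure_integrable_cst.
have iw : gamma.-integrable setT (EFin \o (@weight R d)).
  have := integrableD measurableT i1 iq.
  by apply: eq_integrable => // z _ /=; rewrite -EFinD /weight addrA.
apply: integrable_dominated mf fK _.
have := integrableZl measurableT K iw.
by apply: eq_integrable.
Qed.

(** The second hypothesis says E[phi | x] = 0. It is applied to y - x and to the residual of a
    recentred plan. *)
Lemma Rintegral_Sform_centered (M : 'M[R]_d) (p : V -> V) (phi : Z -> V) :
  vlin_growth phi ->
  (forall A i, measurable A ->
    \int[gamma]_(z in fst @^-1` A) (coord (phi z) i)%:E = 0)%E ->
  measurable_fun setT p -> vlin_growth (p \o fst) ->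
  \int[gamma]_z (Sform M (p z.1) (phi z)) = 0.
Proof.
move=> lphi phi0 mp lp.
under eq_Rintegral do rewrite Sform_coord.
have q i j := lin_growthM (lp i) (lphi j).
rewrite Rintegral_sum => [|i]; last first.
  by apply: integrable_quad; apply: quad_growth_sum => j; exact: quad_growthZ.
apply: big1 => i _; rewrite Rintegral_sum => [|j]; last first.
  by apply: integrable_quad; exact: quad_growthZ.
apply: big1 => j _; rewrite RintegralZl//; last exact: integrable_quad.
suff -> : \int[gamma]_x (coord (p x.1) i * coord (phi x) j) = 0 by rewrite mulr0.
apply: (@integral_comp_mul_eq0 _ _ _ _ _ fst measurable_fst gamma
  (fun z => coord (phi z) j) (fun x => coord (p x) i)).
- by apply: integrable_quad; apply: lin_growth_quad; exact: lphi.
- by move=> A mA; exact: phi0.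
- exact: (measurableT_comp (@measurable_coord R d i) mp).
- exact: (integrable_quad (q i j)).
Qed.

Lemma martingale_centered A i : measurable A ->
  (\int[gamma]_(z in fst @^-1` A) (coord (z.2 - z.1 : V) i)%:E = 0)%E.
Proof.
move=> mA; have mA' : measurable (fst @^-1` A : set Z).
  by rewrite -[X in measurable X]setTI; exact: measurable_fst.
under eq_integral do rewrite /coord mxE [X in _ + X]mxE EFinB.
have i1 : gamma.-integrable (fst @^-1` A) (fun z : Z => (coord z.1 i)%:E).
  exact: (integrableS measurableT mA' (@subsetT _ _)
    (integrable_quad (lin_growth_quad (@vlin_growth_fst R d i)))).
have i2 : gamma.-integrable (fst @^-1` A) (fun z : Z => (coord z.2 i)%:E).
  exact: (integrableS measurableT mA' (@subsetT _ _)
    (integrable_quad (lin_growth_quad (@vlin_growth_snd R d i)))).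
rewrite integralB// Gg.2.2// subee//.
exact: (integrable_fin_num mA' i1).
Qed.

Lemma Rintegral_Sform_martingale (M : 'M[R]_d) (p : V -> V) :
  measurable_fun setT p -> vlin_growth (p \o fst) ->
  \int[gamma]_z (Sform M (p z.1) z.2) = \int[gamma]_z (Sform M (p z.1) z.1).
Proof.
move=> mp lp; apply/eqP; rewrite -subr_eq0; apply/eqP.
have l1 := @vlin_growth_fst R d; have l2 := @vlin_growth_snd R d.
rewrite -RintegralB//; [|exact: (integrable_quad (quad_growth_Sform M lp l2))|
  exact: (integrable_quad (quad_growth_Sform M lp l1))].
under eq_Rintegral do rewrite -SformNr -SformDr.
apply: Rintegral_Sform_centered => //; first exact: vlin_growthB.
by move=> A i mA; exact: martingale_centered.
Qed.

End Plans.

(** * Weak duality *)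

(** Positive and negative parts are compared separately, which allows the infinite integrals that
    [psi] may have. *)
Lemma le_integral_gen dT (T : measurableType dT) (R : realType)
    (mu : {measure set T -> \bar R}) (f g : T -> \bar R) :
  measurable_fun setT f -> measurable_fun setT g -> (forall x, f x <= g x)%E ->
  (\int[mu]_x f x <= \int[mu]_x g x)%E.
Proof.
move=> mf mg fg; rewrite integralE [leRHS]integralE; apply: leeB.
  apply: ge0_le_integral => //; [exact: measurable_funepos|exact: measurable_funepos|].
  by move=> x _; apply: (@funepos_le _ _ setT) => //; exact: in_setT.
apply: ge0_le_integral => //; [exact: measurable_funeneg|exact: measurable_funeneg|].
by move=> x _; apply: (@funeneg_le _ _ setT) => //; exact: in_setT.
Qed.

Lemma Rintegral_le0_ae dT (T : measurableType dT) (R : realType)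
    (mu : {measure set T -> \bar R}) (h : T -> R) :
  mu.-integrable setT (EFin \o h) -> (forall x, 0 <= h x) ->
  \int[mu]_x h x <= 0 -> {ae mu, forall x, h x = 0}.
Proof.
move=> ih h0 hle.
have h_0 : (\int[mu]_x (h x)%:E = 0)%E.
  rewrite -(fineK (integrable_fin_num measurableT ih)); congr EFin.
  by apply/eqP; rewrite eq_le hle/= fine_ge0// integral_ge0// => x _; rewrite lee_fin.
have /ae_eq_integral_abs : measurable_fun setT (EFin \o h) by exact: measurable_int ih.
move=> /(_ mu measurableT)[H _].
have {}H : ae_eq mu setT (EFin \o h) (cst 0%E).
  by apply: H; rewrite -h_0; apply: eq_integral => x _; rewrite /= ger0_norm.
by apply: filterS H => x /(_ I) /= [].
Qed.

Section Duality.
Variables (R : realType) (d m : nat) (S : 'M[R]_d).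
Local Notation V := (vec R d).
Local Notation Z := (V * V)%type.
Local Notation c x := (Sform S x x / 2).
Hypothesis inS : in_Sdm S m.

Let symS : S^T = S. Proof. by case: inS. Qed.

Lemma maxSmonotone_projection_map (G : set V) : maxSmonotone S G ->
  exists g : V -> V, [/\ measurable_fun setT g, vlin_growth (g \o fst),
    (forall x, G (g x)), (forall x, Sform S (g x - x) (g x - x) <= 0) &
    forall x, Sform S (g x - x) (g x - x) = 0 -> g x = x].
Proof.
move=> mG; have [symS' [uS _]] := inS.
have [A [B [Pi [[symA symB SE] [[A0 B0 [K K0 hK]] [PiA PiB]]]]]] :=
  signature_splitting symS' uS.
have AB : exists2 K : R, 0 <= K &
  forall v : V, sqn v <= K * (Sform A v v + Sform B v v) by exists K.
have proj := maxSmonotone_projection symS' symA symB SE A0 B0 AB PiA PiB mG.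
have [g [cg Gg Ag [L L0 gL]]] := exists_projection_map symA SE A0 K0 hK mG.1 proj.
have mg := continuous_measurable_vec cg.
exists g; split => //.
- apply: (@vlin_growth_sqn _ _ _ L) => //.
    exact: (measurableT_comp mg measurable_fst).
  move=> z; apply: le_trans (gL _) _; rewrite ler_wpM2l// /weight lerDl; exact: sqn_ge0.
- by move=> x; rewrite SE SformBm Ag sub0r oppr_le0.
- move=> x; rewrite SE SformBm Ag sub0r => /eqP; rewrite oppr_eq0 => /eqP Bx.
  apply/eqP; rewrite -subr_eq0; apply/eqP; apply: sqn0_eq0.
  by apply: le_trans (hK _) _; rewrite Ag Bx addr0 mulr0.
Qed.

Lemma psi_ge (G : set V) x y : G x -> ((Sform S x y - c x)%:E <= psi S G y)%E.
Proof. by move=> Gx; apply: ereal_sup_ubound; exists x. Qed.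

Lemma psi_le (G : set V) y (r : R) :
  (forall x, G x -> Sform S x y - c x <= r) -> (psi S G y <= r%:E)%E.
Proof.
by move=> h; apply: ge_ereal_sup => _ [x Gx <-]; rewrite lee_fin; exact: h.
Qed.

Lemma PG_psi (G : set V) x y : G x ->
  PG S G y x <-> psi S G y = (Sform S x y - c x)%:E.
Proof.
move=> Gx; split=> [[_ h]|h].
  by apply/eqP; rewrite eq_le psi_ge// psi_le.
by split => // x' Gx'; rewrite -lee_fin -h psi_ge.
Qed.

(** The supremum may run over an uncountable set, but its strict superlevel sets are unions of open
    sets, hence open. *)
Lemma measurable_psi (G : set V) : measurable_fun setT (psi S G).
Proof.
apply: (measurability _ (ErealGenOInfty.measurableE R)) => _ [_ [r ->] <-].
rewrite setTI; apply: open_measurable_vec.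
have -> : psi S G @^-1` `]r%:E, +oo[%classic =
    \bigcup_(x in G) [set y | r < Sform S x y - c x].
  apply/seteqP; split => y /=; rewrite in_itv/= andbT.
    by move=> /ereal_sup_gt[_ [x Gx <-]]; rewrite lte_fin => ?; exists x.
  by move=> [x Gx /= h]; apply: lt_le_trans (psi_ge y Gx); rewrite lte_fin.
apply: bigcup_open => x Gx.
have cf : continuous (fun y : V => Sform S x y - c x).
  have h : continuous (fun y : V => Sform S x y).
    by apply: continuous_Sform => y; [exact: cst_continuous|exact: cvg_id].
  by move=> y; apply: continuousB; [exact: h|exact: cst_continuous].
by move/continuousP : cf => /(_ [set t | r < t]); apply; exact: open_gt.
Qed.

Section Plan.
Variables (nu : probability V R) (gamma : probability Z R).
Hypothesis Gg : Gamma nu gamma.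

Lemma integral_marginal (f : V -> \bar R) : measurable_fun setT f ->
  (\int[nu]_y f y = \int[gamma]_z f z.2)%E.
Proof.
have h (k : V -> \bar R) : (forall y, 0 <= k y)%E -> measurable_fun setT k ->
    (\int[nu]_y k y = \int[gamma]_z k z.2)%E.
  move=> k0 mk; rewrite -[RHS](ge0_integral_pushforward measurable_snd gamma measurableT
    mk)//.
  by apply: eq_measure_integral => A mA _; apply/esym; exact: Gg.2.1.
move=> mf; rewrite integralE [RHS]integralE; congr (_ - _)%E.
  rewrite h//; last exact: measurable_funepos.
  by apply: eq_integral => z _; rewrite !funeposE.
rewrite h//; last exact: measurable_funeneg.
by apply: eq_integral => z _; rewrite !funenegE.
Qed.

Let l1 := @vlin_growth_fst R d.
Let l2 := @vlin_growth_snd R d.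

Lemma quad_growth_qform (u : Z -> V) : vlin_growth u ->
  quad_growth (fun z => c (u z)).
Proof.
move=> lu; have := quad_growthZ 2^-1 (quad_growth_Sform S lu lu).
by under eq_fun do rewrite mulrC.
Qed.

Lemma EFin_Rintegral (f : Z -> R) : quad_growth f ->
  (\int[gamma]_z (f z)%:E = (\int[gamma]_z f z)%:E)%E.
Proof.
move=> qf; rewrite -(fineK (integrable_fin_num measurableT (integrable_quad Gg qf))).
by [].
Qed.

Lemma Rintegral_payoff :
  \int[gamma]_z (Sform S z.1 z.2 - c z.1) = \int[gamma]_z c z.1.
Proof.
have q12 := quad_growth_Sform S l1 l2; have q11 := quad_growth_Sform S l1 l1.
have qc := quad_growth_qform l1.
rewrite RintegralB//; [|exact: (integrable_quad Gg)..].
rewrite (Rintegral_Sform_martingale Gg S (p := id))//.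
have -> : \int[gamma]_z c z.1 = \int[gamma]_z (Sform S z.1 z.1) / 2.
  by rewrite RintegralZr//; exact: (integrable_quad Gg).
by field.
Qed.

Lemma half_integral_Sform :
  ((2^-1)%:E * \int[gamma]_z (Sform S z.1 z.2)%:E = (\int[gamma]_z c z.1)%:E)%E.
Proof.
have q12 := quad_growth_Sform S l1 l2; have q11 := quad_growth_Sform S l1 l1.
rewrite EFin_Rintegral// -EFinM; congr EFin.
rewrite (Rintegral_Sform_martingale Gg S (p := id))//.
by rewrite RintegralZr; [rewrite mulrC|by []|exact: (integrable_quad Gg)].
Qed.

Section WeakDuality.
Variables (G : set V) (g : V -> V).
Hypotheses (mg : measurable_fun setT g) (lg : vlin_growth (g \o fst)).
Hypothesis G_g : forall x, G (g x).

Let f (z : Z) : R := Sform S (g z.1) z.2 - c (g z.1).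

Let qf : quad_growth f.
Proof. by apply: quad_growthB; [exact: quad_growth_Sform|exact: quad_growth_qform]. Qed.

Lemma Rintegral_lower_bound : \int[gamma]_z (Sform S (g z.1) z.2 - c (g z.1)) =
  \int[gamma]_z c z.1 - \int[gamma]_z c (g z.1 - z.1).
Proof.
have qg2 := quad_growth_Sform S lg l2; have qg1 := quad_growth_Sform S lg l1.
have qcg := quad_growth_qform lg; have qc := quad_growth_qform l1.
have qcd := quad_growth_qform (vlin_growthB lg l1).
rewrite RintegralB//; [|exact: (integrable_quad Gg)..].
rewrite (Rintegral_Sform_martingale Gg S mg lg).
rewrite -!RintegralB//; [|exact: (integrable_quad Gg)..].
by apply: eq_Rintegral => z _; rewrite (qform_sub symS); ring.
Qed.

(** The case of equality in weak duality: the slack psi_G(y) - f and - c(g x - x) are nonnegative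
    with total integral at most 0, so both vanish almost surely. Then g x = x, and x attains
    psi_G(y). *)
Lemma ae_PG_of_integral_le :
  (forall x, Sform S (g x - x) (g x - x) <= 0) ->
  (forall x, Sform S (g x - x) (g x - x) = 0 -> g x = x) ->
  (\int[nu]_y psi S G y <= (\int[gamma]_z c z.1)%:E)%E ->
  {ae gamma, forall z, PG S G z.2 z.1}.
Proof.
move=> g_le g_eq; rewrite integral_marginal; last exact: measurable_psi.
(* Truncation at 1 makes the slack integrable without changing where it vanishes. *)
pose D (z : Z) : R := fine (Order.min (psi S G z.2 - (f z)%:E) 1)%E.
have fpsi z : ((f z)%:E <= psi S G z.2)%E by exact: psi_ge.
have DE z : (D z)%:E = (Order.min (psi S G z.2 - (f z)%:E) 1)%E.
  rewrite /D fineK// fin_numElt; apply/andP; split.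
    by rewrite lt_min ltNyr andbT (@lt_le_trans _ _ 0%E)// sube_ge0.
  by rewrite gt_min ltry orbT.
have D0 z : 0 <= D z by rewrite -lee_fin DE le_min sube_ge0// fpsi lee01.
have D1 z : D z <= 1 by rewrite -lee_fin DE ge_min lexx orbT.
have mD : measurable_fun setT D.
  apply/measurable_EFinP; have -> : EFin \o D =
      (fun z => Order.min (psi S G z.2 - (f z)%:E) 1)%E by apply/funext => z; exact: DE.
  apply: measurable_mine => //; apply: emeasurable_funB.
    exact: (measurableT_comp (@measurable_psi G) measurable_snd).
  by apply/measurable_EFinP; case: qf.
have qD : quad_growth D.
  by apply: lin_growth_quad; apply: (@lin_growth_bounded _ _ _ 1) => // z;
    rewrite ger0_norm.
have fD z : ((f z + D z)%:E <= psi S G z.2)%E.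
  rewrite EFinD DE addeC -leeBrDr//.
  by rewrite ge_min lexx.
have qcd := quad_growth_qform (vlin_growthB lg l1).
have qND : quad_growth (fun z => D z - c (g z.1 - z.1)) by exact: quad_growthB.
move=> psi_le.
have : \int[gamma]_z (D z - c (g z.1 - z.1)) <= 0.
  have : ((\int[gamma]_z (f z + D z))%:E <= (\int[gamma]_z c z.1)%:E)%E.
    apply: le_trans psi_le; rewrite -EFin_Rintegral; last exact: quad_growthD.
    apply: le_integral_gen => //.
      by apply/measurable_EFinP; case: (quad_growthD qf qD).
    exact: (measurableT_comp (@measurable_psi G) measurable_snd).
  rewrite lee_fin RintegralD//; [|exact: (integrable_quad Gg)..].
  rewrite Rintegral_lower_bound RintegralB//; [|exact: (integrable_quad Gg)..].
  by lra.
move=> /Rintegral_le0_ae; move=> /(_ (integrable_quad Gg qND)) H.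
have {}H : {ae gamma, forall z, D z - c (g z.1 - z.1) = 0}.
  by apply: H => z; have := D0 z; have := g_le z.1; lra.
apply: filterS H => z H.
have Dz : D z = 0 by have := D0 z; have := g_le z.1; lra.
have gz : g z.1 = z.1 by apply: g_eq; have := D0 z; have := g_le z.1; lra.
have fz : f z = Sform S z.1 z.2 - c z.1 by rewrite /f gz.
apply/PG_psi; first by rewrite -gz.
have := DE z; rewrite Dz -fz => /esym; rewrite /Order.min; case: ifP => _ h.
  by rewrite -(@subeK _ (psi S G z.2) (f z)%:E)// h add0e.
by case: h => /eqP; rewrite oner_eq0.
Qed.

End WeakDuality.

Lemma weak_duality (G : set V) : maxSmonotone S G ->
  ((\int[gamma]_z c z.1)%:E <= \int[nu]_y psi S G y)%E.
Proof.
move=> mG; have [g [mg lg G_g g_le _]] := maxSmonotone_projection_map mG.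
rewrite integral_marginal; last exact: measurable_psi.
have qf : quad_growth (fun z : Z => Sform S (g z.1) z.2 - c (g z.1)).
  by apply: quad_growthB; [exact: quad_growth_Sform|exact: quad_growth_qform].
apply: (@le_trans _ _ (\int[gamma]_z (Sform S (g z.1) z.2 - c (g z.1)))%:E).
  rewrite lee_fin Rintegral_lower_bound// lerDl oppr_ge0 -oppr_ge0.
  have qcd := quad_growth_qform (vlin_growthB lg l1).
  rewrite -mulN1r -RintegralZl//; last exact: (integrable_quad Gg).
  by apply: Rintegral_ge0 => z _; have := g_le z.1; lra.
rewrite -EFin_Rintegral//; apply: le_integral_gen.
- by apply/measurable_EFinP; case: qf.
- exact: (measurableT_comp (@measurable_psi G) measurable_snd).
- by move=> z; exact: psi_ge.
Qed.

Lemma integral_psi_of_ae (G : set V) : {ae gamma, forall z, PG S G z.2 z.1} ->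
  (\int[nu]_y psi S G y = (\int[gamma]_z c z.1)%:E)%E.
Proof.
move=> aeP; rewrite integral_marginal; last exact: measurable_psi.
have q := quad_growthB (quad_growth_Sform S l1 l2) (quad_growth_qform l1).
rewrite -Rintegral_payoff -EFin_Rintegral//; apply: ae_eq_integral => //.
- exact: (measurableT_comp (@measurable_psi G) measurable_snd).
- by apply/measurable_EFinP; case: q.
- apply: filterS aeP => z Pz _; apply/PG_psi => //; exact: Pz.1.
Qed.

End Plan.

(** The two values coincide, and weak duality makes each of them a bound for all competitors of the
    other problem. *)
Lemma optimal_of_ae (nu : probability V R) (gamma : probability Z R) (G : set V) :
  Gamma nu gamma -> maxSmonotone S G -> {ae gamma, forall z, PG S G z.2 z.1} ->
  optimal_plan S nu gamma /\ optimal_set S nu G.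
Proof.
move=> Gg mG aeP; split; last first.
  split => // G' mG'; rewrite (integral_psi_of_ae Gg aeP); exact: weak_duality.
split => // gamma' Gg'.
rewrite (half_integral_Sform Gg) (half_integral_Sform Gg').
by rewrite -(integral_psi_of_ae Gg aeP); exact: weak_duality.
Qed.

End Duality.

(** * First variation of an optimal plan *)

Section Variation.
Variables (R : realType) (d m : nat) (S : 'M[R]_d).
Local Notation V := (vec R d).
Local Notation Z := (V * V)%type.
Local Notation c x := (Sform S x x / 2).
Hypothesis inS : in_Sdm S m.
Variables (nu : probability V R) (gamma : probability Z R).
Hypothesis Gg : Gamma nu gamma.
Hypothesis opt : forall gamma' : probability Z R, Gamma nu gamma' ->
  \int[gamma']_z c z.1 <= \int[gamma]_z c z.1.

Let symS : S^T = S. Proof. by case: inS. Qed.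
Let l1 := @vlin_growth_fst R d.
Let l2 := @vlin_growth_snd R d.

Let ED (f g : Z -> R) : quad_growth f -> quad_growth g ->
  \int[gamma]_z (f z + g z) = \int[gamma]_z f z + \int[gamma]_z g z.
Proof. by move=> qf qg; rewrite RintegralD//; exact: (integrable_quad Gg). Qed.

Let EB (f g : Z -> R) : quad_growth f -> quad_growth g ->
  \int[gamma]_z (f z - g z) = \int[gamma]_z f z - \int[gamma]_z g z.
Proof. by move=> qf qg; rewrite RintegralB//; exact: (integrable_quad Gg). Qed.

Let EZ k (f : Z -> R) : quad_growth f ->
  \int[gamma]_z (k * f z) = k * \int[gamma]_z f z.
Proof. by move=> qf; rewrite RintegralZl//; exact: (integrable_quad Gg). Qed.

(** The bounds on [kap] and its support make [kap] times y - x bounded, as the recentring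
    requires. *)
Definition test_density (kap : Z -> R) := [/\ measurable_fun setT kap,
  exists M : R, forall z, 0 <= kap z <= M,
  exists rho : R, forall z, kap z != 0 ->
    forall i, `|coord z.1 i| <= rho /\ `|coord z.2 i| <= rho &
  \int[gamma]_z kap z = 1].

Definition barycenter (kap : Z -> R) : V :=
  \row_i \int[gamma]_z (kap z * coord z.2 i).

(** The competitor [gamma'] moves the fraction w = eps kap of the mass at (x, y) to (b0, y) and the
    rest to (b x, y), where b x is the new mean of the remaining fibre; y is kept, so the second
    marginal is unchanged. Optimality of [gamma], divided by eps, is the claim. *)
Lemma variation_step (kap : Z -> R) (M C eps K : R) : test_density kap ->
  (forall z, 0 <= kap z <= M) -> 0 < eps -> eps * M <= 2^-1 ->
  (forall z i, `|kap z * (coord z.2 i - coord z.1 i)| <= C) ->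
  0 <= K -> (forall x y : V, `|Sform S x y| <= K * (sqn x + sqn y)) ->
  c (barycenter kap) - eps * (K * \sum_(i < d) (2 * C) ^+ 2) <=
  \int[gamma]_z (kap z * (Sform S z.1 z.2 - c z.1)).
Proof.
move=> [mkap _ _ Ekap] kapM eps0 epsM kapC K0 hK.
set b0 := barycenter kap.
pose w z := eps * kap z.
have mw : measurable_fun setT w by exact: measurable_funM.
have w0 z : 0 <= w z by rewrite mulr_ge0 ?(ltW eps0)//; have /andP[] := kapM z.
have w2 z : w z <= 2^-1.
  by apply: le_trans epsM; rewrite ler_pM2l//; have /andP[] := kapM z.
have w01 z : 0 <= w z <= 1 by have := w0 z; have := w2 z; lra.
have kapb z : `|kap z| <= M by have /andP[h1 h2] := kapM z; rewrite ger0_norm.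
have mv : measurable_fun setT (fun z => 1 - w z) by exact: measurable_funB.
have v01 z : 2^-1 <= 1 - w z <= 1 by have := w0 z; have := w2 z; lra.
have v1 z : `|1 - w z| <= 1 by have := v01 z; rewrite ler_norml; lra.
have wb z : `|w z| <= 1 by rewrite ger0_norm//; have /andP[] := w01 z.
have mth i : measurable_fun setT (fun z : Z => kap z * (coord z.2 i - coord z.1 i)).
  by apply: measurable_funM => //; apply: measurable_funB; [case: (l2 i)|case: (l1 i)].
have /choice[f hf] : forall i, exists f : V -> R, [/\ measurable_fun setT f,
    (forall u, `|f u| <= 2 * C) & forall A, measurable A ->
    (\int[gamma]_(z in fst @^-1` A)
      (kap z * (coord z.2 i - coord z.1 i) - (1 - w z) * f z.1)%:E = 0)%E].
  move=> i; exact: (exists_weighted_conditional_expectation gamma measurable_fst mv v01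
    (mth i) (fun z => kapC z i)).
pose fv x : V := \row_i f i x.
have fvE x i : coord (fv x) i = f i x by rewrite /coord mxE.
(* Given x, (1 - w)(y - x) has mean - eps E[kap (y - x) | x], and [fv] is the weighted mean that
   this shift compensates. *)
pose b x : V := x - eps *: fv x.
have bE x i : coord (b x) i = coord x i - eps * f i x by rewrite -fvE /coord !mxE.
have mfv : measurable_fun setT fv.
  apply: measurable_fun_vec => i; have [mf _ _] := hf i.
  by rewrite (_ : (fun x => _) = f i)//; apply/funext => x; exact: fvE.
have mb : measurable_fun setT b.
  apply: measurable_fun_vec => i; have [mf _ _] := hf i.
  rewrite (_ : (fun x => _) = (fun x => coord x i - eps * f i x)).
    by apply: measurable_funB; [exact: measurable_coord|exact: measurable_funM].
  by apply/funext => x; exact: bE.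
have mfvb : measurable_fun setT (fv \o fst : Z -> V)
  by exact: (measurableT_comp mfv measurable_fst).
have mbf : measurable_fun setT (b \o fst : Z -> V)
  by exact: (measurableT_comp mb measurable_fst).
have lfv : vlin_growth (fv \o fst).
  move=> i; apply: (@lin_growth_bounded _ _ _ (2 * C)).
    exact: (measurableT_comp (@measurable_coord R d i) mfvb).
  by move=> z; rewrite /= fvE; have [_ + _] := hf i.
have lb : vlin_growth (b \o fst).
  apply: vlin_growthB => //.
  by apply: (@vlin_growthZ _ _ (cst eps) _ `|eps|).
pose T0 (z : Z) : Z := (b z.1, z.2); pose T1 (z : Z) : Z := (b0, z.2).
have mT0 : measurable_fun setT T0 by exact: measurable_fun_pair.
have mT1 : measurable_fun setT T1 by exact: measurable_fun_pair.
have [gamma' QE] := exists_mixture gamma mw w01 mT0 mT1.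
have mix (F : Z -> R) : measurable_fun setT F ->
    quad_growth (F \o T0) -> quad_growth (F \o T1) ->
    gamma'.-integrable setT (EFin \o F) /\
    \int[gamma']_z F z = \int[gamma]_z (w z * F (T1 z) + (1 - w z) * F (T0 z)).
  move=> mF q0 q1; apply: mixture_Rintegral mw w01 mT0 mT1 QE mF _ _;
    exact: (integrable_quad Gg).
pose phi (z : Z) : V := (1 - w z) *: (z.2 - b z.1).
have lphi : vlin_growth phi.
  by apply: (vlin_growthZ mv v1); exact: vlin_growthB.
have phiE z i : coord (phi z) i = coord (z.2 - z.1 : V) i -
    eps * (kap z * (coord z.2 i - coord z.1 i) - (1 - w z) * f i z.1).
  have := bE z.1 i; rewrite /phi /coord !mxE => ->; rewrite /w; ring.
have phi0 A i : measurable A -> (\int[gamma]_(z in fst @^-1` A) (coord (phi z) i)%:E = 0)%E.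
  move=> mA; have mA' : measurable (fst @^-1` A : set Z).
    by rewrite -[X in measurable X]setTI; exact: measurable_fst.
  have [mf fC f_0] := hf i.
  under eq_integral do rewrite phiE EFinB EFinM.
  have i1 : gamma.-integrable (fst @^-1` A) (fun z : Z => (coord (z.2 - z.1 : V) i)%:E).
    exact: (integrableS measurableT mA' (@subsetT _ _)
      (integrable_quad Gg (lin_growth_quad (vlin_growthB l2 l1 i)))).
  have q2 : quad_growth (fun z : Z =>
      kap z * (coord z.2 i - coord z.1 i) - (1 - w z) * f i z.1).
    apply: quad_growthB; apply: lin_growth_quad.
      exact: lin_growth_bounded (fun z => kapC z i).
    apply: (lin_growthMb mv v1); apply: lin_growth_bounded (fun z => fC z.1).
    exact: (measurableT_comp mf measurable_fst).
  have i2 : gamma.-integrable (fst @^-1` A) (fun z : Z =>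
      (kap z * (coord z.2 i - coord z.1 i) - (1 - w z) * f i z.1)%:E).
    exact: (integrableS measurableT mA' (@subsetT _ _) (integrable_quad Gg q2)).
  rewrite integralB//; last exact: integrableZl.
  by rewrite (martingale_centered Gg)// integralZl// f_0// mule0 sube0.
have Gg' : Gamma nu gamma'.
  split; [|split].
  - have [|||+ _] := mix (fun z => sqn z.1 + sqn z.2).
    + by apply: measurable_funD; apply: measurable_sqn.
    + under [X in quad_growth X]eq_fun do rewrite /= !sqn_Sform.
      by apply: quad_growthD; exact: quad_growth_Sform.
    + under [X in quad_growth X]eq_fun do rewrite /= !sqn_Sform.
      apply: quad_growthD; last exact: quad_growth_Sform.
      by apply: quad_growth_Sform; exact: vlin_growth_cst.
    + exact: integrable_lty.
  - move=> A mA; have mB : measurable (snd @^-1` A : set Z).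
      by rewrite -[X in measurable X]setTI; exact: measurable_snd.
    have := QE (fun z => (\1_(snd @^-1` A) z)%:E).
    rewrite integral_indic// setIT => ->.
    + transitivity (\int[gamma]_z (\1_(snd @^-1` A) z)%:E)%E; last first.
        by rewrite integral_indic// setIT; exact: Gg.2.1.
      apply: eq_integral => z _; rewrite -!EFinM -EFinD; congr EFin.
      have -> : \1_(snd @^-1` A) (T1 z) = \1_(snd @^-1` A) z :> R 
        by rewrite !indicE; congr
          ((nat_of_bool _)%:R); apply/idP/idP => /set_mem h; exact: mem_set.
      have -> : \1_(snd @^-1` A) (T0 z) = \1_(snd @^-1` A) z :> R 
        by rewrite !indicE; congr
          ((nat_of_bool _)%:R); apply/idP/idP => /set_mem h; exact: mem_set.
      by ring.
    + by move=> z; rewrite lee_fin.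
    + exact/measurable_EFinP/measurable_indic.
  - move=> A mA i; have mA' : measurable (fst @^-1` A : set Z).
      by rewrite -[X in measurable X]setTI; exact: measurable_fst.
    pose ind (x : V) : R := \1_A x.
    have mind : measurable_fun setT ind by exact: measurable_indic.
    have indb x : `|ind x| <= 1
      by rewrite /ind indicE; case: (_ \in _); rewrite ?normr1 ?normr0.
    have mindf : measurable_fun setT (ind \o fst : Z -> R)
      by exact: (measurableT_comp mind measurable_fst).
    have mindb : measurable_fun setT (ind \o (b \o fst) : Z -> R)
      by exact: (measurableT_comp mind mbf).
    have mindc : measurable_fun setT (cst (ind b0) : Z -> R) by exact: measurable_cst.
    have cond (k : Z -> R) : (\int[gamma']_(z in fst @^-1` A) (k z)%:E =
        \int[gamma']_z (ind z.1 * k z)%:E)%E.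
      rewrite integral_mkcond; apply: eq_integral => z _.
      have zA : (z \in fst @^-1` A) = (z.1 \in A).
        by apply/idP/idP => /set_mem h; exact: mem_set.
      by rewrite patchE /ind indicE zA; case: ifP => _; rewrite ?mul1r ?mul0r.
    have [||| ik1 Ek1] := mix (fun z => ind z.1 * coord z.2 i).
      by apply: measurable_funM => //; case: (l2 i).
      by apply: lin_growth_quad; apply: (lin_growthMb mindb (fun z => indb _)); exact: l2.
      by apply: lin_growth_quad; exact: (lin_growthMb mindc (fun z => indb b0) (l2 i)).
    have [||| ik2 Ek2] := mix (fun z => ind z.1 * coord z.1 i).
      by apply: measurable_funM => //; case: (l1 i).
      by apply: lin_growth_quad; apply: (lin_growthMb mindb (fun z => indb _)); exact: lb.
      by apply: lin_growth_quad;
        exact: (lin_growthMb mindc (fun z => indb b0) (vlin_growth_cst b0 i)).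
    rewrite !cond -(fineK (integrable_fin_num measurableT ik1)).
    rewrite -(fineK (integrable_fin_num measurableT ik2)); congr EFin.
    rewrite -!/(Rintegral _ _ _) Ek1 Ek2 /=.
    have q1 : quad_growth (fun z : Z => w z * (ind b0 * coord z.2 i)).
      apply: (quad_growthMb mw wb); apply: quad_growthZ; apply: lin_growth_quad; exact: l2.
    have q1' : quad_growth (fun z : Z => w z * (ind b0 * coord b0 i)).
      apply: (quad_growthMb mw wb); apply: quad_growthZ; apply: lin_growth_quad.
      exact: (vlin_growth_cst b0).
    have q2 : quad_growth (fun z : Z => (1 - w z) * (ind (b z.1) * coord z.2 i)).
      apply: (quad_growthMb mv v1); apply: (quad_growthMb mindb (fun z => indb _)).
      by apply: lin_growth_quad; exact: l2.
    have q2' : quad_growth (fun z : Z => (1 - w z) * (ind (b z.1) * coord (b z.1) i)).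
      apply: (quad_growthMb mv v1); apply: (quad_growthMb mindb (fun z => indb _)).
      by apply: lin_growth_quad; exact: lb.
    (* The two pieces are centred separately: the moved mass because [b0] is its barycenter and
       [kap] has integral 1, the rest because [phi] has conditional mean 0 given x. Testing with a
       set in the new coordinate b x is testing with a function of x. *)
    rewrite !ED//; congr (_ + _); apply/eqP; rewrite -subr_eq0 -EB//; apply/eqP.
      have qk : quad_growth (fun z : Z => kap z * coord z.2 i).
        by apply: lin_growth_quad; apply: (lin_growthMb mkap kapb); exact: l2.
      have qk' : quad_growth kap by apply: lin_growth_quad; exact: lin_growth_bounded kapb.
      transitivity (\int[gamma]_z ((ind b0 * eps) * (kap z * coord z.2 i) -
          (ind b0 * eps * coord b0 i) * kap z)).
        by apply: eq_Rintegral => z _; rewrite /w; ring.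
      rewrite EB; [|exact: quad_growthZ..].
      by rewrite !EZ// Ekap {2}/coord mxE; ring.
    transitivity (\int[gamma]_z (ind (b z.1) * coord (phi z) i)).
      by apply: eq_Rintegral => z _; rewrite /phi /coord !mxE; ring.
    apply: (@integral_comp_mul_eq0 _ _ _ _ _ fst measurable_fst gamma
      (fun z => coord (phi z) i) (ind \o b)).
    + by apply: (integrable_quad Gg); apply: lin_growth_quad; exact: lphi.
    + by move=> A' mA0; exact: phi0.
    + exact: (measurableT_comp mind mb).
    + apply: (integrable_quad Gg); apply: lin_growth_quad.
      by apply: (lin_growthMb mindb (fun z => indb _)); exact: lphi.
have := opt Gg'.
have qc0 := quad_growth_qform S lb; have qcf := quad_growth_qform S lfv.
have qb0 := quad_growth_qform S (vlin_growth_cst b0).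
have [||| _ ->] := mix (fun z => c z.1) => //.
  apply: measurable_funM => //; exact: (measurable_Sform _ measurable_fst measurable_fst).
have qp := quad_growthB (quad_growth_Sform S l1 l2) (quad_growth_qform S l1).
rewrite -(Rintegral_payoff S Gg).
pose pay (z : Z) := Sform S z.1 z.2 - c z.1.
have qphi := quad_growth_Sform S l1 lphi.
have qk' : quad_growth kap by apply: lin_growth_quad; exact: lin_growth_bounded kapb.
have qkp := quad_growthMb mkap kapb qp.
have qvc := quad_growthMb mv v1 qcf.
(* Exact expansion of the new value. The term with [phi] integrates to 0, and the last one is the
   second-order cost of recentring, bounded below through the bound 2 C on [fv]. *)
rewrite (_ : \int[gamma]_z _ = \int[gamma]_z (pay z - eps * (kap z * pay z) +
    (eps * c b0) * kap z - Sform S z.1 (phi z) + (eps ^+ 2) * ((1 - w z) * c (fv z.1)))).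
  rewrite ED; last 2 first.
  - by apply: quad_growthB => //; apply: quad_growthD; [apply: quad_growthB => //|];
      exact: quad_growthZ.
  - exact: quad_growthZ.
  rewrite EB//; last by apply: quad_growthD; [apply: quad_growthB => //|];
    exact: quad_growthZ.
  rewrite ED; [|by apply: quad_growthB => //; exact: quad_growthZ|exact: quad_growthZ].
  rewrite EB//; last exact: quad_growthZ.
  rewrite !EZ// Ekap (Rintegral_Sform_centered Gg S lphi phi0 (p := id))//.
  have : - (K * \sum_(i < d) (2 * C) ^+ 2) <= \int[gamma]_z ((1 - w z) * c (fv z.1)).
    have -> : - (K * \sum_(i < d) (2 * C) ^+ 2) =
        \int[gamma]_z (cst (- (K * \sum_(i < d) (2 * C) ^+ 2)) z).
      have g1 : fine (gamma setT) = 1 by rewrite (@probability_setT _ _ _ gamma).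
      by rewrite Rintegral_cst// [fine _]g1 mulr1.
    apply: le_Rintegral => //.
    - exact: finite_measure_integrable_cst.
    - exact: (integrable_quad Gg).
    move=> z _ /=; set s := \sum_(i < d) _.
    have sf : sqn (fv z.1) <= s.
      apply: ler_sum => i _; rewrite fvE; have [_ + _] := hf i => /(_ z.1).
      by move=> h; rewrite -real_normK ?num_real// ler_pXn2r ?nnegrE// (le_trans _ h).
    have cf : `|c (fv z.1)| <= K * s.
      rewrite normrM [`|2^-1|]ger0_norm ?invr_ge0// ler_pdivrMr//.
      apply: le_trans (hK _ _) _; rewrite -mulrA ler_wpM2l//; lra.
    have : `|(1 - w z) * c (fv z.1)| <= K * s.
      by rewrite normrM -[leRHS]mul1r ler_pM.
    by rewrite ler_norml => /andP[].
  move: (K * _) (\int[gamma]_z ((1 - w z) * _)) (c b0) => k r cb hr.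
  rewrite -/(pay _); move: (\int[gamma]_z pay z) (\int[gamma]_z (kap z * pay z)) => p q h.
  rewrite -(ler_pM2l eps0); rewrite expr2 in h; nra.
apply: eq_Rintegral => z _; rewrite /pay /T1 /T0 /=.
have bx : b z.1 - z.1 = - (eps *: fv z.1) by rewrite /b addrAC subrr add0r.
have cb : c (b z.1) = Sform S (b z.1) z.1 - c z.1 + eps ^+ 2 * c (fv z.1).
  have := qform_sub symS (b z.1) z.1; rewrite bx SformNl SformNr SformZl SformZr => h.
  by rewrite expr2; lra.
rewrite cb /phi SformZr SformDr SformNr (SformC (b z.1) z.1 symS) /w.
by ring.
Qed.

Lemma variation (kap : Z -> R) : test_density kap ->
  c (barycenter kap) <= \int[gamma]_z (kap z * (Sform S z.1 z.2 - c z.1)).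
Proof.
move=> tk; have [mkap [M kapM] [rho hrho] Ekap] := tk.
have M0 : 0 <= M by have := kapM (0, 0); lra.
have [K K0 hK] := Sform_le_sqn S.
pose C := M * (2 * `|rho|).
have kapC z i : `|kap z * (coord z.2 i - coord z.1 i)| <= C.
  have [->|kz] := eqVneq (kap z) 0; first by rewrite mul0r normr0 !mulr_ge0.
  have [h1 h2] := hrho z kz i; rewrite normrM ler_pM//.
    by rewrite ger0_norm; have /andP[] := kapM z.
  rewrite (le_trans (ler_normB _ _))//.
  by have := ler_norm rho; lra.
(* Ensures eps M <= 1/2 for every eps = t e0 with t <= 1, so at least half of each mass stays; then
   t tends to 0. *)
pose e0 := (2 * (M + 1))^-1.
have e00 : 0 < e0 by rewrite invr_gt0 mulr_gt0//; lra.
have e0M : e0 * M <= 2^-1.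
  by rewrite /e0 invfM -mulrA ler_piMr// mulrC ler_pdivrMr; lra.
rewrite -subr_ge0.
apply: (@ge0_of_small_multiples _ (- (e0 * (K * \sum_(i < d) (2 * C) ^+ 2)))).
move=> t /andP[t0 t1].
have te : 0 < t * e0 by exact: mulr_gt0.
have teM : t * e0 * M <= 2^-1.
  rewrite -mulrA; apply: le_trans e0M; rewrite ler_piMl// mulr_ge0// ltW//.
have := variation_step tk kapM te teM kapC K0 hK.
by rewrite mulrN mulrA; lra.
Qed.

End Variation.

(** * Strong duality *)

Lemma negligible_bigcup_count dT (T : measurableType dT) (R : realType)
    (mu : {measure set T -> \bar R}) (I : countType) (P : set I) (F : I -> set T) :
  (forall i, P i -> mu.-negligible (F i)) -> mu.-negligible (\bigcup_(i in P) F i).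
Proof.
move=> nF; rewrite bigcup_count_nat; apply: negligible_bigcup => n.
case: pickle_inv => [i|]; last exact: negligible_set0.
by case: asboolP => [Pi|_]; [exact: nF|exact: negligible_set0].
Qed.

(** One point of [G] is chosen in each rational box that meets it; [x0] fills the other indices. *)
Lemma exists_dense_seq (R : realType) (d : nat) (G : set (vec R d)) : G !=set0 ->
  exists D : nat -> vec R d, (forall n, G (D n)) /\
  forall x U, G x -> nbhs x U -> exists n, U (D n).
Proof.
move=> [x0 Gx0].
have /choice[p hp] : forall qk, exists y, G y /\
    ((exists x, G x /\ ratbox qk x) -> ratbox qk y).
  move=> qk; have [[x [Gx qx]]|h] := pselect (exists x, G x /\ ratbox (R := R) qk x).
    by exists x.
  by exists x0; split => // /h.
exists (fun n => if @unpickle _ n is Some qk then p qk else x0); split.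
  by move=> n; case: unpickle => // qk; have [] := hp qk.
move=> x U Gx /ratbox_nbhs[qk xqk qkU]; exists (pickle qk); rewrite pickleK.
by apply: qkU; apply: (hp qk).2; exists x.
Qed.

Lemma continuous_score (R : realType) (d : nat) (S : 'M[R]_d) (T : topologicalType)
    (u v : T -> vec R d) : continuous u -> continuous v ->
  continuous (fun t => Sform S (u t) (v t) - Sform S (u t) (u t) / 2).
Proof.
move=> cu cv t; have h1 := @continuous_Sform R d S _ _ _ cu cv t.
have h2 := @continuous_Sform R d S _ _ _ cu cu t.
apply: (@cvgB _ _ _ (nbhs t) _ (fun t => Sform S (u t) (v t))) h1 _.
exact: (@cvgMl _ _ (nbhs t) _ _ _ _ h2).
Qed.

Section StrongDuality.
Variables (R : realType) (d m : nat) (S : 'M[R]_d).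
Local Notation V := (vec R d).
Local Notation Z := (V * V)%type.
Local Notation c x := (Sform S x x / 2).
Hypothesis inS : in_Sdm S m.
Variables (nu : probability V R) (gamma : probability Z R).
Hypothesis Gg : Gamma nu gamma.

Let symS : S^T = S. Proof. by case: inS. Qed.
Let l1 := @vlin_growth_fst R d.
Let l2 := @vlin_growth_snd R d.

Lemma measurable_weight : measurable_fun setT (@weight R d).
Proof.
apply: measurable_funD; [apply: measurable_funD => //|]; apply: measurable_sqn.
  exact: measurable_fst.
exact: measurable_snd.
Qed.

Lemma test_density_indic (N : set Z) (n : nat) : measurable N ->
  N `<=` [set z | weight z <= n%:R] -> gamma N != 0%E ->
  test_density gamma (fun z => (fine (gamma N))^-1 * \1_N z).
Proof.
move=> mN Nn gN0.
have gN : 0 < fine (gamma N).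
  rewrite fine_gt0// lt0e gN0 measure_ge0/=.
  by rewrite ltey_eq fin_num_measure.
have i1 : \int[gamma]_z (\1_N z) = fine (gamma N).
  by rewrite /Rintegral integral_indic// setIT.
split.
- by apply: measurable_funM => //; exact: measurable_indic.
- exists (fine (gamma N))^-1 => z.
  rewrite indicE; case: (_ \in _); rewrite ?mulr1 ?mulr0 ?lexx ?andbT invr_ge0 ltW//.
- exists n%:R => z; rewrite indicE; have [/set_mem /Nn /= zn _ i|]
    := boolP (z \in N); last first.
    by rewrite mulr0 eqxx.
  (* With n >= 1, a^2 <= n implies |a| <= n, so [n] itself bounds the coordinates. *)
  have n1 : 1 <= n%:R :> R by exact: le_trans (weight_ge1 z) zn.
  have h (a : R) : a ^+ 2 <= n%:R -> `|a| <= n%:R.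
    move=> an; rewrite -(@ler_pXn2r _ 2)// ?nnegrE ?ler0n// real_normK ?num_real//.
    by rewrite (le_trans an)// expr2 ler_peMr// ler0n.
  split; apply: h; apply: le_trans zn.
    apply: le_trans (coord_sqr_le z.1 i) _; rewrite /weight.
    by have := sqn_ge0 z.2; lra.
  apply: le_trans (coord_sqr_le z.2 i) _; rewrite /weight.
  by have := sqn_ge0 z.1; lra.
- rewrite RintegralZl//; first by rewrite i1 mulVf// gt_eqF.
  by apply: (@bounded_integrable _ _ _ _ _ 1) => // z; rewrite indicE;
    case: (_ \in _); rewrite ?normr1 ?normr0.
Qed.

(** The set where [del] is negative is exhausted by its parts with bounded weight; the normalised
    indicator of a non-null part would be a test density with negative integral. *)
Lemma ae_ge0_of_test (del : Z -> R) : quad_growth del ->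
  (forall kap, test_density gamma kap -> 0 <= \int[gamma]_z (kap z * del z)) ->
  {ae gamma, forall z, 0 <= del z}.
Proof.
move=> qdel h; have mdel : measurable_fun setT del by case: qdel.
pose N n := [set z : Z | del z < 0] `&` [set z | weight z <= n%:R].
have mN n : measurable (N n).
  apply: measurableI.
    by rewrite -[X in measurable X]setTI; apply: (measurable_fun_ltr mdel) => //;
      exact: measurable_cst.
  rewrite -[X in measurable X]setTI.
  by apply: (measurable_fun_ler measurable_weight) => //; exact: measurable_cst.
have N0 n : gamma.-negligible (N n).
  apply/negligibleP; first exact: mN.
  apply/eqP; apply: contraT => gN0.
  have tk := test_density_indic (mN n) (@subIsetr _ _ _) gN0.
  have := h _ tk; under eq_Rintegral do rewrite -mulrA.
  have mi : measurable_fun setT (\1_(N n) : Z -> R) by exact: measurable_indic.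
  have ib z : `|(\1_(N n) : Z -> R) z| <= 1.
    by rewrite indicE; case: (_ \in _); rewrite ?normr1 ?normr0.
  have qi : quad_growth (fun z : Z => \1_(N n) z * del z) by exact: (quad_growthMb mi ib).
  rewrite RintegralZl//; last exact: (integrable_quad Gg).
  have gN : 0 < fine (gamma (N n)).
    by rewrite fine_gt0// lt0e gN0 measure_ge0/= ltey_eq fin_num_measure.
  rewrite pmulr_rge0 ?invr_gt0// => hpos.
  have qi' := quad_growthZ (-1) qi.
  have : {ae gamma, forall z, -1 * (\1_(N n) z * del z) = 0}.
    apply: Rintegral_le0_ae.
    - exact: (integrable_quad Gg).
    - move=> z; rewrite indicE; have [/set_mem[/= dz _]|_] := boolP (z \in N n).
        by rewrite mul1r mulN1r oppr_ge0 ltW.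
      by rewrite mul0r mulr0.
    - by rewrite RintegralZl//; [rewrite mulN1r oppr_le0|exact: (integrable_quad Gg)].
  move=> ae; suff /negligibleP : gamma.-negligible (N n)
    by move=> /(_ (mN n)) gN1; move: gN0; rewrite gN1 eqxx.
  apply: negligibleS ae => z Nz /=; rewrite indicE mem_set// mul1r mulN1r.
  by case: Nz => /= dz _ /eqP; rewrite oppr_eq0 => /eqP d0; rewrite d0 ltxx in dz.
have : gamma.-negligible (\bigcup_n N n) by exact: negligible_bigcup.
apply: negligibleS => z /= /negP; rewrite -ltNge => dz.
exists (Num.truncn (weight z)).+1 => //; split => //=.
by apply/ltW; exact: truncnS_gt.
Qed.

(** Otherwise [ae_ge0_of_test] would hold vacuously for the constant -1. *)
Lemma exists_test_density : exists kap, test_density gamma kap.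
Proof.
apply: contrapT => h; have : {ae gamma, forall z : Z, 0 <= (-1 : R)}.
  apply: (@ae_ge0_of_test (cst (-1))).
    by apply: lin_growth_quad; apply: (@lin_growth_bounded _ _ _ 1) => // z;
      rewrite normrN1.
  by move=> kap tk; exfalso; apply: h; exists kap.
move=> h1; have /negligibleP : gamma.-negligible (setT : set Z).
  by apply: negligibleS h1 => z _ /=; rewrite ler0N1.
move=> /(_ measurableT) g0; have := @probability_setT _ _ _ gamma.
by move=> g1; move: g0; rewrite [LHS]g1 => -[/eqP]; rewrite oner_eq0.
Qed.

Lemma Sform_barycenter (x : V) (kap : Z -> R) : test_density gamma kap ->
  Sform S x (barycenter gamma kap) = \int[gamma]_z (kap z * Sform S x z.2).
Proof.
move=> [mkap [M kapM] _ _].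
have kapb z : `|kap z| <= M by have /andP[h1 h2] := kapM z; rewrite ger0_norm.
have q j : quad_growth (fun z : Z => kap z * coord z.2 j).
  by apply: lin_growth_quad; apply: (lin_growthMb mkap kapb); exact: l2.
rewrite Sform_coord.
transitivity (\int[gamma]_z (\sum_i \sum_j (S i j * coord x i) * (kap z * coord z.2 j))).
  rewrite Rintegral_sum => [|i]; last first.
    by apply: (integrable_quad Gg); apply: quad_growth_sum => j; exact: quad_growthZ.
  apply: eq_bigr => i _; rewrite Rintegral_sum => [|j]; last first.
    by apply: (integrable_quad Gg); exact: quad_growthZ.
  apply: eq_bigr => j _; rewrite RintegralZl//; last exact: (integrable_quad Gg).
  by rewrite mulrA {2}/coord mxE.
apply: eq_Rintegral => z _; rewrite Sform_coord mulr_sumr; apply: eq_bigr => i _.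
by rewrite mulr_sumr; apply: eq_bigr => j _; ring.
Qed.

Lemma strong_duality :
  (forall gamma' : probability Z R, Gamma nu gamma' ->
    \int[gamma']_z c z.1 <= \int[gamma]_z c z.1) ->
  exists2 G : set V, maxSmonotone S G &
    (\int[nu]_y psi S G y <= (\int[gamma]_z c z.1)%:E)%E.
Proof.
move=> opt; have [_ [uS _]] := inS.
have [A [B [Pi [[symA symB SE] [[A0 B0 AB] [PiA PiB]]]]]] := signature_splitting symS uS.
pose pay (z : Z) := Sform S z.1 z.2 - c z.1.
have qp : quad_growth pay.
  exact: (quad_growthB (quad_growth_Sform S l1 l2) (quad_growth_qform S l1)).
have qkf kap f : test_density gamma kap -> quad_growth f ->
    quad_growth (fun z : Z => kap z * f z).
  move=> [mkap [M kapM] _ _] qf; apply: (quad_growthMb (C := M) mkap) => //.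
  by move=> z; have /andP[h1 h2] := kapM z; rewrite ger0_norm.
(* Convex because barycenter and mean payoff are linear in [kap]; above the graph of [c] by
   [variation]. *)
pose E1 : set (V * R) := [set e | exists2 kap, test_density gamma kap &
  e = (barycenter gamma kap, \int[gamma]_z (kap z * pay z))].
have comb (kap kap' f : Z -> R) t : test_density gamma kap -> test_density gamma kap' ->
    quad_growth f -> \int[gamma]_z ((t * kap z + (1 - t) * kap' z) * f z) =
    t * \int[gamma]_z (kap z * f z) + (1 - t) * \int[gamma]_z (kap' z * f z).
  move=> tk tk' qf; have q1 := qkf _ _ tk qf; have q2 := qkf _ _ tk' qf.
  rewrite -!RintegralZl//; [|exact: (integrable_quad Gg)..].
  rewrite -RintegralD//; [|by apply: (integrable_quad Gg); exact: quad_growthZ..].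
  by apply: eq_Rintegral => z _; ring.
have [] := @exists_maxSmonotone_below _ _ S A B Pi symS symA symB SE A0 B0 AB PiA PiB E1.
- have [kap tk] := exists_test_density.
  by exists (barycenter gamma kap, \int[gamma]_z (kap z * pay z)); exists kap.
- move=> _ _ _ _ t [kap tk [-> ->]] [kap' tk' [-> ->]] /andP[t0 t1].
  exists (fun z => t * kap z + (1 - t) * kap' z); last first.
    congr (_, _); last by rewrite comb.
    apply/rowP => i; rewrite !mxE comb//.
    by apply: lin_growth_quad; exact: l2.
  have [mk [M kM] [rho hr] Ek] := tk; have [mk' [M' kM'] [rho' hr'] Ek'] := tk'.
  have q1 : quad_growth (cst 1 : Z -> R).
    by apply: lin_growth_quad; apply: (@lin_growth_bounded _ _ _ 1) => // z; rewrite normr1.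
  split.
  + by apply: measurable_funD; exact: measurable_funM.
  + exists (M + M') => z; have := kM z; have := kM' z => /andP[a1 a2] /andP[b1 b2].
    by apply/andP; split; nra.
  + exists (`|rho| + `|rho'|) => z kz i.
    have h1 := ler_norm rho; have h2 := ler_norm rho'.
    have n1 := normr_ge0 rho; have n2 := normr_ge0 rho'.
    have [k0|k0] := eqVneq (kap z) 0.
      have [k0'|k0'] := eqVneq (kap' z) 0.
        by move: kz; rewrite k0 k0' !mulr0 addr0 eqxx.
      by have [e1 e2] := hr' z k0' i; split; lra.
    by have [e1 e2] := hr z k0 i; split; lra.
  + have := comb _ _ _ t tk tk' q1.
    have e (k : Z -> R) : \int[gamma]_z (k z * cst 1 z) = \int[gamma]_z k z.
      by apply: eq_Rintegral => z _; rewrite mulr1.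
    by rewrite !e => ->; rewrite Ek Ek'; ring.
- by move=> _ _ [kap tk [-> ->]]; exact: (variation inS Gg opt).
move=> G [mG below _ _]; exists G => //.
(* The bound by [pay] holds outside a null set that depends on the point of [G]; a dense sequence
   and continuity give one null set for the whole supremum. *)
have [D [GD dD]] := exists_dense_seq (maxSmonotone_nonempty mG).
have aeD : {ae gamma, forall z, forall n, Sform S (D n) z.2 - c (D n) <= pay z}.
  have h n : {ae gamma, forall z, 0 <= pay z - (Sform S (D n) z.2 - c (D n))}.
    have qS := quad_growth_Sform S (vlin_growth_cst (D n)) l2.
    have qc := quad_growth_qform S (vlin_growth_cst (D n)).
    have q2 := quad_growthB qS qc.
    apply: ae_ge0_of_test; first exact: quad_growthB.
    move=> kap tk; have [_ _ _ Ek] := tk.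
    have e1 : E1 (barycenter gamma kap, \int[gamma]_z (kap z * pay z)) by exists kap.
    have := below _ _ _ (GD n) e1; rewrite Sform_barycenter// => hb.
    rewrite (_ : \int[gamma]_z _ = \int[gamma]_z (kap z * pay z -
      (kap z * Sform S (D n) z.2 - c (D n) * kap z))); last first.
      by apply: eq_Rintegral => z _; ring.
    have qk : quad_growth kap.
      have [mkap [M kapM] _ _] := tk; apply: lin_growth_quad.
      apply: (@lin_growth_bounded _ _ _ M) => // z.
      by have /andP[h1 h2] := kapM z; rewrite ger0_norm.
    rewrite RintegralB//; last 2 first.
    - by apply: (integrable_quad Gg); exact: qkf.
    - by apply: (integrable_quad Gg); apply: quad_growthB; [exact: qkf|exact: quad_growthZ].
    rewrite RintegralB//; last 2 first.
    - by apply: (integrable_quad Gg); exact: qkf.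
    - by apply: (integrable_quad Gg); exact: quad_growthZ.
    rewrite RintegralZl//; last exact: (integrable_quad Gg).
    by rewrite Ek mulr1; lra.
  have : gamma.-negligible (\bigcup_n
      ~` [set z : Z | 0 <= pay z - (Sform S (D n) z.2 - c (D n))]).
    by apply: negligible_bigcup => n; exact: h.
  apply: negligibleS => z /= /existsNP[n hn]; exists n => //=.
  by rewrite subr_ge0.
have aepsi : {ae gamma, forall z, (psi S G z.2 <= (pay z)%:E)%E}.
  apply: filterS aeD => z hz; apply: psi_le => x Gx; rewrite leNgt; apply/negP => lt.
  have cf : continuous (fun x' : V => Sform S x' z.2 - c x').
    by apply: continuous_score => y; [exact: cvg_id|exact: cst_continuous].
  have [n] := dD x [set x' | pay z < Sform S x' z.2 - c x'] Gx
    (cf x _ (open_nbhs_nbhs (conj (@open_gt _ (pay z)) lt))).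
  by rewrite /= ltNge hz.
rewrite (integral_marginal Gg); last exact: measurable_psi.
have mpsi : measurable_fun setT (fun z : Z => psi S G z.2).
  exact: (measurableT_comp (@measurable_psi _ _ S G) measurable_snd).
have mpay : measurable_fun setT (fun z : Z => (pay z)%:E).
  by apply/measurable_EFinP; case: qp.
rewrite -(Rintegral_payoff S Gg) -(EFin_Rintegral Gg qp).
(* The bound holds only almost everywhere; the maximum dominates [psi] everywhere and equals [pay]
   almost everywhere. *)
apply: (@le_trans _ _ (\int[gamma]_z (Order.max (psi S G z.2) (pay z)%:E))%E).
  apply: le_integral_gen => //; first exact: measurable_maxe.
  by move=> z; rewrite le_max lexx.
rewrite le_eqVlt; apply/orP; left; apply/eqP; apply: ae_eq_integral => //.
  exact: measurable_maxe.
by apply: filterS aepsi => z hz _; apply/max_idPr.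
Qed.

End StrongDuality.

(** * Support and projections *)

Section Support.
Variables (R : realType) (d : nat) (S : 'M[R]_d).
Local Notation V := (vec R d).
Local Notation Z := (V * V)%type.
Local Notation c x := (Sform S x x / 2).
Variable gamma : probability Z R.

(** Every point outside the support lies in a null product of rational boxes, and there are
    countably many of these. *)
Lemma ae_supp : {ae gamma, forall z, supp gamma z}.
Proof.
pose F (pq : ('rV[rat]_d * nat) * ('rV[rat]_d * nat)) : set Z :=
  ratbox pq.1 `*` ratbox pq.2.
have : gamma.-negligible (\bigcup_(pq in [set pq | gamma (F pq) = 0%E]) F pq).
  apply: negligible_bigcup_count => pq /= F0; apply/negligibleP => //.
  by apply: measurableX; apply: open_measurable_vec; exact: open_ratbox.
apply: negligibleS => z /= /existsNP[A /existsNP[B]].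
move=> /not_implyP[oA /not_implyP[oB /not_implyP[Az /not_implyP[Bz g0]]]].
have [p pz pA] := ratbox_nbhs (open_nbhs_nbhs (conj oA Az)).
have [q qz qB] := ratbox_nbhs (open_nbhs_nbhs (conj oB Bz)).
exists (p, q) => //=.
have mF : measurable (F (p, q)).
  by apply: measurableX; apply: open_measurable_vec; exact: open_ratbox.
apply/eqP; rewrite eq_le measure_ge0 andbT.
have AB0 : (gamma (A `*` B) <= 0)%E by rewrite leNgt; apply/negP.
apply: le_trans AB0; apply: le_measure; rewrite ?inE//.
  by apply: measurableX; exact: open_measurable_vec.
by move=> u [/= /pA ? /qB ?].
Qed.

Lemma supp_of_ae (P : set Z) : {ae gamma, forall z, P z} ->
  forall z, supp gamma z -> ~ nbhs z (~` P).
Proof.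
move=> [N [mN N0 PN]] z sz [[A B] /= [nA nB] ABP].
have := sz A^° B^° (open_interior A) (open_interior B) nA nB.
apply/negP; rewrite -leNgt -N0; apply: le_measure; rewrite ?inE//.
  by apply: measurableX; apply: open_measurable_vec; exact: open_interior.
move=> u [/= Au Bu]; apply: PN => /=; apply: ABP; split => /=; exact: interior_subset.
Qed.

(** Failure of x in P_G(y) is an open condition: either a competitor is strictly better, or x is
    outside [G], and maximality then gives a point of [G] at which monotonicity fails strictly. Both
    persist nearby. *)
Lemma PG_supp (G : set V) : maxSmonotone S G ->
  {ae gamma, forall z, PG S G z.2 z.1} -> forall z, supp gamma z -> PG S G z.2 z.1.
Proof.
move=> mG aeP z sz; apply: contrapT => nP.
have cfst : continuous (fst : Z -> V) by move=> u; exact: cvg_fst.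
have csnd : continuous (snd : Z -> V) by move=> u; exact: cvg_snd.
apply: (supp_of_ae aeP sz).
have [Gz|Gz] := pselect (G z.1).
  have [x' [Gx' lt]] : exists x', G x' /\
      Sform S z.1 z.2 - c z.1 < Sform S x' z.2 - c x'.
    apply: contrapT => h; apply: nP; split => // x' Gx'; rewrite leNgt; apply/negP => lt.
    by apply: h; exists x'.
  have h1 := @continuous_score R d S _ _ _ cfst csnd.
  have h2 : continuous (fun u : Z => Sform S x' u.2 - c x').
    by apply: (@continuous_score R d S _ (cst x') snd) => // u; exact: cst_continuous.
  have cf : continuous (fun u : Z => (Sform S x' u.2 - c x') - (Sform S u.1 u.2 - c u.1)).
    by move=> u; apply: (@cvgB _ _ _ (nbhs u) _ _ _ _ _ (h2 u) (h1 u)).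
  have lt0 : 0 < (Sform S x' z.2 - c x') - (Sform S z.1 z.2 - c z.1) by rewrite subr_gt0.
  have nz : nbhs z [set u : Z | 0 < (Sform S x' u.2 - c x') - (Sform S u.1 u.2 - c u.1)].
    exact: (cf z _ (open_nbhs_nbhs (conj (@open_gt _ 0) lt0))).
  by apply: filterS nz => u /= hu [_ /(_ _ Gx')]; lra.
have [x [Gx lt]] : exists x, G x /\ Sform S (x - z.1) (x - z.1) < 0.
  apply: contrapT => h; apply: Gz; apply: (maxSmonotone_mem mG) => x Gx.
  by rewrite leNgt; apply/negP => lt; apply: h; exists x.
have csub : continuous (fun u : Z => x - u.1).
  by move=> u; apply: (@cvgB _ _ _ (nbhs u) _ (cst x) fst);
    [exact: cst_continuous|exact: cfst].
have cf := @continuous_Sform R d S _ _ _ csub csub.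
have nz : nbhs z [set u : Z | Sform S (x - u.1) (x - u.1) < 0].
  exact: (cf z _ (open_nbhs_nbhs (conj (@open_lt _ 0) lt))).
apply: filterS nz => u /= hu [Gu _]; have := mG.1 _ _ Gx Gu.
by move: hu; lra.
Qed.

End Support.

(** * Inclusion of P_G(x) in P_G(y) for almost every pair *)

Section Projections.
Variables (R : realType) (d : nat) (S : 'M[R]_d) (nu : probability (vec R d) R).
Local Notation V := (vec R d).
Local Notation Z := (V * V)%type.
Local Notation c x := (Sform S x x / 2).
Hypothesis symS : S^T = S.
Variables (gamma : probability Z R) (G : set V).
Hypotheses (Gg : Gamma nu gamma) (mG : maxSmonotone S G).
Hypothesis aeP : {ae gamma, forall z, PG S G z.2 z.1}.

Let l1 := @vlin_growth_fst R d.
Let l2 := @vlin_growth_snd R d.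

Let gap (z : Z) (x : V) := (Sform S z.1 z.2 - c z.1) - (Sform S x z.2 - c x).

Lemma measurable_gap (x : V) : measurable_fun setT (fun z => gap z x).
Proof.
have qS := quad_growth_Sform S (vlin_growth_cst x) l2.
have qc := quad_growth_qform S (vlin_growth_cst x).
by have [] := quad_growthB (quad_growthB (quad_growth_Sform S l1 l2)
  (quad_growth_qform S l1)) (quad_growthB qS qc).
Qed.

Lemma measurable_qform_sub (x : V) : measurable_fun setT (fun u : V => c (u - x)).
Proof.
apply: measurable_funM => //.
have ms : measurable_fun setT (fun u : V => u - x).
  apply: measurable_fun_vec => i.
  rewrite (_ : (fun u => _) = (fun u : V => coord u i - coord x i)).
    by apply: measurable_funB => //; exact: measurable_coord.
  by apply/funext => u; rewrite /coord !mxE.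
exact: measurable_Sform.
Qed.

Variable D : nat -> V.
Hypothesis GD : forall n, G (D n).

(** For x in [G], c(x - x') is what x' in [G] lacks to maximise the score defining P_G(x), so here
    [D n] is an approximate projection of x inside the box. *)
Let W qk k n : set V := [set x | ratbox qk (D n) /\ c (x - D n) < k.+1%:R^-1].

Let mW qk k n : measurable (W qk k n).
Proof.
have [h|h] := pselect (ratbox qk (D n)).
  rewrite (_ : W qk k n = [set x | c (x - D n) < k.+1%:R^-1]).
    rewrite -[X in measurable X]setTI.
    by apply: (measurable_fun_ltr (measurable_qform_sub (D n))) => //;
      exact: measurable_cst.
  by apply/seteqP; split => x; [case|split].
by rewrite (_ : W qk k n = set0)//; apply/seteqP; split => x // [].
Qed.

(** The bad pairs: the box contains approximate projections of x of every accuracy, yet all points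
    [D n] of the box miss the score of x against y by at least 1/(l+1). *)
Let N qk l : set Z := [set z | (forall k, exists n, W qk k n z.1) /\
  forall n, ratbox qk (D n) -> l.+1%:R^-1 <= gap z (D n)].

Let mN qk l : measurable (N qk l).
Proof.
rewrite (_ : N qk l = (\bigcap_k \bigcup_n (fst @^-1` W qk k n)) `&`
    \bigcap_(n in [set n | ratbox qk (D n)]) [set z | l.+1%:R^-1 <= gap z (D n)]).
  apply: measurableI.
    apply: bigcapT_measurable => k; apply: bigcupT_measurable => n.
    by rewrite -[X in measurable X]setTI; exact: measurable_fst.
  apply: bigcap_measurableType => n _; rewrite -[X in measurable X]setTI.
  by apply: (measurable_fun_ler _ (measurable_gap (D n))) => //; exact: measurable_cst.
apply/seteqP; split => z.
  by move=> [h1 h2]; split => [k _|n /= qn]; [have [n hn] := h1 k; exists n|exact: h2].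
by move=> [h1 h2]; split => [k|n qn]; [have [n _ hn] := h1 k I; exists n|exact: h2].
Qed.

(* Over [N] the point [D n] with [n] minimal is a bounded measurable choice of an
   almost minimiser of [c (x - .)]; testing the martingale property with it
   bounds the integral of the gap. *)
Lemma negligible_gap qk l : gamma.-negligible (N qk l).
Proof.
apply/negligibleP; first exact: mN.
have bound k : fine (gamma (N qk l)) * l.+1%:R^-1 <= k.+1%:R^-1.
  pose A := seqDU (W qk k).
  have mA n : measurable (A n) by apply: measurableD => //; exact: bigsetU_measurable.
  have tA : trivIset setT A by exact: trivIset_seqDU.
  pose idx x := xget 0%N [set n | A n x].
  have idxE n x : A n x -> idx x = n.
    move=> Anx; rewrite /idx; case: xgetP => [j _ Ajx|/(_ n)//].
    by apply: tA => //; exists x.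
  pose UA := \bigcup_n A n.
  have mUA : measurable UA by exact: bigcupT_measurable.
  have idx0 x : ~ UA x -> idx x = 0%N.
    by move=> nU; rewrite /idx; case: xgetP => // j _ Ajx; case: nU; exists j.
  pose sel x := D (idx x).
  have msel : measurable_fun setT sel.
    move=> _ Bs mBs; rewrite setTI.
    have -> : sel @^-1` Bs = \bigcup_(n in [set n | Bs (D n)]) A n `|`
        (if `[< Bs (D 0%N) >] then ~` UA else set0).
      apply/seteqP; split => x /=.
        move=> Bx; have [[n _ An]|nU] := pselect (UA x).
          by left; exists n => //=; rewrite -(idxE _ _ An).
        by right; rewrite -(idx0 _ nU); case: asboolP.
      move=> [[n /= Bn An]|]; first by rewrite /sel (idxE _ _ An).
      by case: asboolP => // B0 nU; rewrite /sel idx0.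
    apply: measurableU; first by apply: bigcup_measurable.
    by case: asboolP => // _; exact: measurableC.
  have UAE x : UA x = (exists n, W qk k n x).
    rewrite /UA -seqDU_bigcup_eq.
    by apply/propext; split => [[n _ ?]|[n ?]]; exists n.
  have selW x : UA x -> ratbox qk (sel x) /\ c (x - sel x) < k.+1%:R^-1.
    move=> [n _ An]; rewrite /sel (idxE _ _ An).
    by have [] : W qk k n x by exact: (subset_seqDU An).
  have lsel : vlin_growth (sel \o fst).
    move=> i; apply: (@lin_growth_bounded _ _ _
      (`|coord (D 0%N) i| + (`|ratr (qk.1 0 i)| + qk.2.+1%:R^-1))).
      exact: (measurableT_comp (measurableT_comp
        (@measurable_coord R d i) msel) measurable_fst).
    move=> z /=; have [U|nU] := pselect (UA z.1).
      have [/(_ i) h _] := selW _ U; rewrite ler_wpDl//.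
      rewrite -[coord _ _](subrK (ratr (qk.1 0 i))) (le_trans (ler_normD _ _))//.
      by rewrite addrC lerD2l ltW.
    by rewrite /sel idx0// ler_wpDr// addr_ge0// invr_ge0.
  pose ind (x : V) : R := \1_UA x.
  have mind : measurable_fun setT ind by exact: measurable_indic.
  have indb x : `|ind x| <= 1 by rewrite /ind indicE; case: (_ \in _);
    rewrite ?normr1 ?normr0.
  have ind0 x : 0 <= ind x by rewrite /ind indicE.
  have mindf : measurable_fun setT (ind \o fst : Z -> R)
    by exact: (measurableT_comp mind measurable_fst).
  pose p x : V := ind x *: (x - sel x).
  have lp : vlin_growth (p \o fst).
    by apply: (vlin_growthZ mindf (fun z => indb _)); exact: vlin_growthB.
  have mp : measurable_fun setT p.
    apply: measurable_fun_vec => i.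
    rewrite (_ : (fun u => _) = (fun u : V => ind u * (coord u i - coord (sel u) i))).
      apply: measurable_funM => //; apply: measurable_funB; first exact: measurable_coord.
      exact: (measurableT_comp (@measurable_coord R d i) msel).
    by apply/funext => u; rewrite /coord !mxE.
  have qcx := quad_growth_qform S l1; have qcs := quad_growth_qform S lsel.
  have qh : quad_growth (fun z : Z => ind z.1 * (c (sel z.1) - c z.1)).
    by apply: (quad_growthMb mindf (fun z => indb _)); exact: quad_growthB.
  have q2 := quad_growth_Sform S lp l2; have q1 := quad_growth_Sform S lp l1.
  have qd := quad_growth_qform S (vlin_growthB l1 lsel).
  have qid := quad_growthMb mindf (fun z => indb _) qd.
  pose h (z : Z) := ind z.1 * gap z (sel z.1).
  have hE z : h z = Sform S (p z.1) z.2 + ind z.1 * (c (sel z.1) - c z.1).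
    by rewrite /h /gap /p SformZl SformDl SformNl; ring.
  have qhh : quad_growth h.
    by rewrite (_ : h = (fun z => Sform S (p z.1) z.2 + ind z.1 * (c (sel z.1) - c z.1)));
      [exact: quad_growthD|exact/funext].
  (* [h] depends on y only through S(p x, y), and the martingale property replaces y by x; the gap
     at y = x is c(x - sel x). *)
  have Eh : \int[gamma]_z h z = \int[gamma]_z (ind z.1 * c (z.1 - sel z.1)).
    under eq_Rintegral do rewrite hE.
    rewrite RintegralD//; [|exact: (integrable_quad Gg)..].
    rewrite (Rintegral_Sform_martingale Gg S mp lp) -RintegralD//;
      [|exact: (integrable_quad Gg)..].
    apply: eq_Rintegral => z _; rewrite /p SformZl SformDl SformNl.
    by rewrite (qform_sub symS) (SformC z.1 (sel z.1) symS); field.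
  have Eh_le : \int[gamma]_z h z <= k.+1%:R^-1.
    rewrite Eh; have -> : k.+1%:R^-1 = \int[gamma]_z (cst k.+1%:R^-1 z) :> R.
      have g1 : fine (gamma setT) = 1 by rewrite (@probability_setT _ _ _ gamma).
      by rewrite Rintegral_cst// [fine _]g1 mulr1.
    apply: le_Rintegral => //.
    - exact: (integrable_quad Gg).
    - exact: finite_measure_integrable_cst.
    move=> z _ /=; rewrite /ind indicE; have [/set_mem/selW[_ /ltW]|_] := boolP (_ \in _).
      by rewrite mul1r.
    by rewrite mul0r invr_ge0.
  apply: le_trans Eh_le.
  have -> : fine (gamma (N qk l)) * l.+1%:R^-1 =
      \int[gamma]_z (l.+1%:R^-1 * \1_(N qk l) z).
    rewrite RintegralZl//.
      by rewrite /Rintegral integral_indic// setIT mulrC.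
    by apply: (@bounded_integrable _ _ _ _ _ 1) => // z; rewrite indicE;
      case: (_ \in _); rewrite ?normr1 ?normr0.
  have mi : measurable_fun setT (fun z : Z => l.+1%:R^-1 * \1_(N qk l) z : R).
    by apply: measurable_funM => //; exact: measurable_indic.
  have ib : gamma.-integrable setT (EFin \o (fun z : Z => l.+1%:R^-1 * \1_(N qk l) z : R)).
    apply: (@bounded_integrable _ _ _ _ _ l.+1%:R^-1) => // z; rewrite indicE.
    by case: (_ \in _); rewrite ?mulr1 ?mulr0 ?normr0 ?invr_ge0// ger0_norm ?invr_ge0.
  have ih := integrable_quad Gg qhh.
  rewrite -subr_ge0 -RintegralB//.
  (* The gap is nonnegative only almost surely, so the difference is replaced by its positive part,
     equal to it almost everywhere. *)
  rewrite (_ : \int[gamma]_z _ = \int[gamma]_z (Num.max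
    (h z - l.+1%:R^-1 * \1_(N qk l) z) 0)).
    by apply: Rintegral_ge0 => z _; rewrite le_max lexx orbT.
  have mhr : measurable_fun setT (fun z => h z - l.+1%:R^-1 * \1_(N qk l) z).
    by apply: measurable_funB => //; case: qhh.
  rewrite /Rintegral; congr fine; apply: ae_eq_integral => //.
  - exact/measurable_EFinP.
  - by apply/measurable_EFinP; exact: measurable_maxr.
  apply: filterS aeP => z [Gz Pz] _; congr EFin; apply/esym/max_idPl; rewrite subr_ge0.
  have gz n : 0 <= gap z (D n) by rewrite subr_ge0; exact: Pz.
  rewrite indicE; have [/set_mem[N1 N2]|_] := boolP (z \in N qk l).
    have Uz : UA z.1 by rewrite UAE; exact: N1.
    rewrite mulr1 /h /ind indicE mem_set// mul1r; apply: N2.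
    by have [] := selW _ Uz.
  by rewrite mulr0 mulr_ge0//; exact: gz.
have l0 : 0 < (l.+1%:R^-1 : R) by rewrite invr_gt0.
have g0 : 0 <= fine (gamma (N qk l)) by rewrite fine_ge0// measure_ge0.
have : fine (gamma (N qk l)) * l.+1%:R^-1 <= 0.
  apply: (cvgr_to_ge (@cvg_harmonic R)).
  by apply: nearW => k; exact: bound.
rewrite pmulr_lle0// => gle.
rewrite -[LHS]fineK; last exact: fin_num_measure.
by congr EFin; apply/eqP; rewrite eq_le gle.
Qed.

Hypothesis dD : forall x U, G x -> nbhs x U -> exists n, U (D n).

(** A point x' in P_G(x) has c(x - x') = 0. If it is not in P_G(y), its gap exceeds some 1/(l+1) on
    a rational box around it, and density provides points [D n] of this box with c(x - D n)
    arbitrarily small: the pair is in some [N]. *)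
Lemma ae_PG_subset_of_dense :
  {ae gamma, forall z, PG S G z.1 z.1 /\ PG S G z.1 `<=` PG S G z.2}.
Proof.
have aeN : {ae gamma, forall z, forall qkl, ~ N qkl.1 qkl.2 z}.
  have : gamma.-negligible (\bigcup_(qkl in [set: ('rV[rat]_d * nat) * nat]) N qkl.1 qkl.2).
    by apply: negligible_bigcup_count => qkl _; exact: negligible_gap.
  apply: negligibleS => z /= /existsNP[qkl /contrapT hN].
  by exists qkl.
apply: filterS2 aeP aeN => z [Gz Pz] nN.
have self x x' : G x -> G x' -> Sform S x' x - c x' <= Sform S x x - c x.
  move=> Gx Gx'; have := mG.1 _ _ Gx' Gx; have := qform_sub symS x' x.
  by move: (Sform S (x' - x) _) (Sform S x' x) => a b; lra.
split; first by split => // x' Gx'; exact: self.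
move=> x' [Gx' hx']; apply: contrapT => nP.
have cx' : c (z.1 - x') = 0.
  have := hx' _ Gz; have := mG.1 _ _ Gz Gx'; have := qform_sub symS z.1 x'.
  rewrite (SformC z.1 x' symS).
  by move: (Sform S (z.1 - x') _) (Sform S x' z.1) => a b; lra.
have gap0 : 0 < gap z x'.
  rewrite subr_gt0 ltNge; apply/negP => le; apply: nP; split => // u Gu.
  exact: le_trans (Pz _ Gu) le.
have [l hl] : exists l : nat, l.+1%:R^-1 < gap z x'.
  have /cvgrPdist_lt/(_ _ gap0)[l _ hl] := @cvg_harmonic R.
  by exists l; have := hl l (leqnn l); rewrite /= sub0r normrN ger0_norm ?invr_ge0.
have cgap : continuous (fun u : V => gap z u).
  have h2 : continuous (fun u : V => Sform S u z.2 - c u).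
    by apply: continuous_score => u; [exact: cvg_id|exact: cst_continuous].
  move=> u; apply: (@cvgB _ _ _ (nbhs u) _ (cst (Sform S z.1 z.2 - c z.1)) _ _ _ _ (h2 u)).
  exact: cst_continuous.
have nU := cgap x' _ (open_nbhs_nbhs (conj (@open_gt _ (l.+1%:R^-1 : R)) hl)).
have [qk qkx qkU] := ratbox_nbhs nU.
apply: (nN (qk, l)); split => /= [k|n /qkU /ltW//].
have cc : continuous (fun u : V => c (z.1 - u)).
  have cE (u : V) : c (z.1 - u) = c z.1 - (Sform S u z.1 - c u).
    by rewrite (qform_sub symS) (SformC z.1 u symS); ring.
  rewrite (_ : (fun u => _) = (fun u : V => c z.1 - (Sform S u z.1 - c u)));
    last exact/funext.
  have h2 : continuous (fun u : V => Sform S u z.1 - c u).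
    by apply: continuous_score => u; [exact: cvg_id|exact: cst_continuous].
  move=> u; apply: (@cvgB _ _ _ (nbhs u) _ (cst (c z.1)) _ _ _ _ (h2 u)).
  exact: cst_continuous.
have ltk : c (z.1 - x') < k.+1%:R^-1 by rewrite cx' invr_gt0.
have n1 : nbhs x' [set u : V | c (z.1 - u) < k.+1%:R^-1].
  exact: (cc x' _ (open_nbhs_nbhs (conj (@open_lt _ (k.+1%:R^-1 : R)) ltk))).
have n2 : nbhs x' (ratbox (R := R) qk).
  by apply: open_nbhs_nbhs; split => //; exact: open_ratbox.
by have [n [h1 h2]] := dD Gx' (filterI n1 n2); exists n; split.
Qed.

End Projections.

Theorem theorem2 (R : realType) (d m : nat) (S : 'M[R]_d)
  (nu : probability (vec R d) R)
  (gamma : probability (vec R d * vec R d)%type R) (G : set (vec R d)) :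
  in_Sdm S m -> finite_second_moment nu ->
  Gamma nu gamma -> maxSmonotone S G ->
  [<-> optimal_plan S nu gamma /\ optimal_set S nu G;
       forall z, supp gamma z -> PG S G z.2 z.1;
       {ae gamma, forall z, PG S G z.1 z.1 /\ PG S G z.1 `<=` PG S G z.2}].
Proof.
move=> inS _ Gg mG; have symS : S^T = S by case: inS.
tfae.
- move=> [[_ optp] [_ opts]]; apply: PG_supp => //.
  have [g [mg lg G_g g_le g_eq]] := maxSmonotone_projection_map inS mG.
  have opt (gamma' : probability (vec R d * vec R d)%type R) : Gamma nu gamma' ->
      \int[gamma']_z (Sform S z.1 z.1 / 2) <= \int[gamma]_z (Sform S z.1 z.1 / 2).
    move=> Gg'; have := optp _ Gg'.
    by rewrite (half_integral_Sform S Gg) (half_integral_Sform S Gg') lee_fin.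
  have [G' mG' hG'] := strong_duality inS Gg opt.
  (* Optimality of [G] transfers the bound from the set [G'] of strong duality to [G], which gives
     equality in weak duality. *)
  apply: (ae_PG_of_integral_le inS Gg mg lg G_g g_le g_eq).
  exact: le_trans (opts _ mG') hG'.
- move=> h; have aeP : {ae gamma, forall z, PG S G z.2 z.1}.
    by apply: filterS (ae_supp gamma) => z; exact: h.
  have [D [GD dD]] := exists_dense_seq (maxSmonotone_nonempty mG).
  exact: (ae_PG_subset_of_dense symS Gg mG aeP GD dD).
(* The two parts of the last condition combine to x in P_G(y) almost surely. *)
- move=> h; apply: (optimal_of_ae inS) => //.
  by apply: filterS h => z [Pz sub]; exact: sub.
Qed.
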